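(* Let $\mathcal{A}$ be a completely contractive Banach algebra, let $E$ and $F$ be completely contractive left $\mathcal{A}$-modules, and let $T:E\rightarrow F$ be a completely bounded $\mathcal{A}$-module homomorphism. The following are equivalent: (1) $T$ is weakly compact; (2) there exist a completely contractive left $\mathcal{A}$-module $G$ which is reflexive, an injective complete contraction $\iota:G\rightarrow F$, and a completely bounded map $R:E\rightarrow G$ with $\|R\|_{cb}=\|T\|_{cb}$ and $T=\iota R$, such that $R$ and $\iota$ are $\mathcal{A}$-module homomorphisms.
   Context: All operator spaces are complete; $\widehat{\otimes}$ is the operator space projective tensor product. A completely contractive (CC) Banach algebra is a Banach algebra $\mathcal{A}$ which is also an operator space and for which the multiplication $a\otimes b\mapsto ab$ extends to a complete contraction $\mathcal{A}\widehat{\otimes}\mathcal{A}\to\mathcal{A}$ (no unit is assumed). A completely contractive (CC) left $\mathcal{A}$-module is a left $\mathcal{A}$-module $E$ which is an operator space and for which the module action $a\otimes x\mapsto a\cdot x$ extends to a complete contraction $\mathcal{A}\widehat{\otimes}E\to E$; equivalently, the induced homomorphism $\mathcal{A}\to\mathcal{CB}(E)$ is well defined and a complete contraction. A linear map $T:E\to F$ between left $\mathcal{A}$-modules is an $\mathcal{A}$-module homomorphism if $T(a\cdot x)=a\cdot T(x)$ for all $a\in\mathcal{A}$, $x\in E$. An operator space is reflexive if its underlying Banach space is reflexive. *)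

(* Defs.v *)
From HB Require Import structures.
From mathcomp Require Import all_boot all_order all_algebra.
From mathcomp Require Import generic_quotient.
From mathcomp Require Import complex mxtens.
From mathcomp Require Import boolp classical_sets functions reals ereal.
From mathcomp Require Import topology normedtype.

Set Implicit Arguments.
Unset Strict Implicit.
Unset Printing Implicit Defensive.

Import Order.TTheory GRing.Theory Num.Theory.
Import numFieldNormedType.Exports.

Local Open Scope classical_set_scope.
Local Open Scope quotient_scope.
Local Open Scope complex_scope.
Local Open Scope ring_scope.

(* [`|z|] lives in [R[i]]; this is the same number in [R]. *)
Definition absc (R : realType) (z : R[i]) : R := complex.Re `|z|.

(* Scalar matrices, normed as operators between Euclidean spaces. *)
Definition l2norm (R : realType) n (x : 'cV[R[i]]_n) : R :=
  Num.sqrt (\sum_i absc (x i 0) ^+ 2).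

Definition opnorm (R : realType) m n (a : 'M[R[i]]_(m, n)) : R :=
  sup [set l2norm (a *m x) | x in [set x | l2norm x <= 1]].

(* The bimodule product [a x b] for scalar [a], [b] and vector-valued [x]. *)
Definition mxsandwich (C : nzRingType) (V : lmodType C) m n p q
    (a : 'M[C]_(m, n)) (x : 'M[V]_(n, p)) (b : 'M[C]_(p, q)) : 'M[V]_(m, q) :=
  \matrix_(i, j) \sum_k \sum_l (a i k * b l j) *: x k l.

(* Complete abstract operator spaces (Ruan's axioms). Completeness is that of
   the underlying Banach space, which is [M_1]; by [mxnormM] it passes to every
   matrix level. The (trivial) level [n = 0] is included. *)
HB.mixin Record isOperatorSpace (R : realType) V
    of CompleteNormedModule R[i] V := {
  mxnorm : forall n, 'M[V]_n -> R;
  mxnorm1 : forall x : V, (mxnorm 1 (const_mx x))%:C = `|x|;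
  mxnorm_eq0 : forall n (x : 'M[V]_n), mxnorm n x = 0 -> x = 0;
  mxnormZ : forall n (c : R[i]) (x : 'M[V]_n),
    mxnorm n (map_mx ( *:%R c) x) = absc c * mxnorm n x;
  mxnormD : forall n (x y : 'M[V]_n),
    mxnorm n (x + y) <= mxnorm n x + mxnorm n y;
  mxnorm_dsum : forall m n (x : 'M[V]_m) (y : 'M[V]_n),
    mxnorm (m + n) (block_mx x 0 0 y) = Num.max (mxnorm m x) (mxnorm n y);
  mxnormM : forall m n (a : 'M[R[i]]_(m, n)) (x : 'M[V]_n)
      (b : 'M[R[i]]_(n, m)),
    mxnorm m (mxsandwich a x b) <= opnorm a * mxnorm n x * opnorm b
}.

#[short(type="opSpaceType")]
HB.structure Definition OperatorSpace (R : realType) :=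
  { V of isOperatorSpace R V & CompleteNormedModule R[i] V }.

Arguments mxnorm {R s n} _.

Section cb_maps.
Variables (R : realType) (E F : opSpaceType R).

Definition cbnorm (T : {linear E -> F}) : \bar R :=
  ereal_sup [set r : \bar R | exists n (x : 'M[E]_n),
    mxnorm x <= 1 /\ r = (mxnorm (map_mx T x))%:E].

Definition completely_bounded (T : {linear E -> F}) := (cbnorm T < +oo)%E.

Definition complete_contraction (T : {linear E -> F}) := (cbnorm T <= 1)%E.

End cb_maps.

(* The algebraic tensor product: finite formal sums of pairs, two of them being
   identified when no bilinear map distinguishes them. *)
Section algebraic_tensor.
Variables (R : realType) (E F : lmodType R[i]).

Definition fsum_eval (W : lmodType R[i]) (b : E -> F -> W) (u : seq (E * F)) :=
  \sum_(p <- u) b p.1 p.2.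

Definition fsum_eq (u v : seq (E * F)) : bool :=
  `[< forall (W : lmodType R[i]) (b : {bilinear E -> F -> W}),
      fsum_eval b u = fsum_eval b v >].

Lemma fsum_eq_equiv : equiv_class_of fsum_eq.
Proof.
split.
- by move=> u; apply/asboolP.
- by move=> u v; apply/asboolP/asboolP => h W b; rewrite h.
- move=> v u w /asboolP h1 /asboolP h2; apply/asboolP => W b.
  by rewrite h1.
Qed.

Canonical fsum_equiv := EquivRelPack fsum_eq_equiv.

Definition tensor := {eq_quot fsum_equiv}.

HB.instance Definition _ := Choice.on tensor.
HB.instance Definition _ : EqQuotient (seq (E * F)) fsum_equiv tensor :=
  EqQuotient.on tensor.

Lemma tensorP u v : \pi_tensor u = \pi_tensor v <->
  forall (W : lmodType R[i]) (b : {bilinear E -> F -> W}),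
    fsum_eval b u = fsum_eval b v.
Proof.
split=> [/eqmodP/asboolP //|h].
by apply/eqmodP/asboolP.
Qed.

Definition tens (x : E) (y : F) : tensor := \pi_tensor [:: (x, y)].

Definition fsumZ (c : R[i]) (u : seq (E * F)) := [seq (c *: p.1, p.2) | p <- u].

Lemma fsum_eval_cat (W : lmodType R[i]) (b : E -> F -> W) u v :
  fsum_eval b (u ++ v) = fsum_eval b u + fsum_eval b v.
Proof. by rewrite /fsum_eval big_cat. Qed.

Lemma fsum_evalZ (W : lmodType R[i]) (b : {bilinear E -> F -> W}) c u :
  fsum_eval b (fsumZ c u) = c *: fsum_eval b u.
Proof.
rewrite /fsum_eval big_map scaler_sumr.
by apply: eq_bigr => p _; rewrite /= linearZl_LR.
Qed.

Lemma fsum_eval_repr (W : lmodType R[i]) (b : {bilinear E -> F -> W}) u :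
  fsum_eval b (repr (\pi_tensor u)) = fsum_eval b u.
Proof. by move: W b; apply/tensorP; rewrite reprK. Qed.

Let tzero : tensor := \pi_tensor [::].
Let topp (t : tensor) : tensor := \pi_tensor (fsumZ (-1) (repr t)).
Let tadd (s t : tensor) : tensor := \pi_tensor (repr s ++ repr t).
Let tscale (c : R[i]) (t : tensor) : tensor := \pi_tensor (fsumZ c (repr t)).

Let evalE := (fsum_eval_repr, fsum_eval_cat, fsum_evalZ).

Let fsum_eval0 (W : lmodType R[i]) (b : E -> F -> W) : fsum_eval b [::] = 0.
Proof. by rewrite /fsum_eval big_nil. Qed.

Let taddA : associative tadd.
Proof. by move=> s t u; apply/tensorP => W b; rewrite !evalE addrA. Qed.

Let taddC : commutative tadd.
Proof. by move=> s t; apply/tensorP => W b; rewrite !evalE addrC. Qed.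

Let tadd0 : left_id tzero tadd.
Proof.
move=> t; rewrite -[RHS]reprK; apply/tensorP => W b.
by rewrite !evalE fsum_eval0 add0r.
Qed.

Let taddN : left_inverse tzero topp tadd.
Proof.
move=> t; apply/tensorP => W b.
by rewrite !evalE fsum_eval0 scaleN1r addNr.
Qed.

HB.instance Definition _ :=
  GRing.isZmodule.Build tensor taddA taddC tadd0 taddN.

Let tscaleA c d t : tscale c (tscale d t) = tscale (c * d) t.
Proof. by apply/tensorP => W b; rewrite !evalE scalerA. Qed.

Let tscale1 : left_id 1 tscale.
Proof.
move=> t; rewrite -[RHS]reprK; apply/tensorP => W b.
by rewrite !evalE scale1r.
Qed.

Let tscaleDr : right_distributive tscale +%R.
Proof. by move=> c s t; apply/tensorP => W b; rewrite !evalE scalerDr. Qed.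

Let tscaleDl t : {morph tscale^~ t : c d / c + d}.
Proof. by move=> c d; apply/tensorP => W b; rewrite !evalE scalerDl. Qed.

HB.instance Definition _ := GRing.Zmodule_isLmodule.Build R[i] tensor
  tscaleA tscale1 tscaleDr tscaleDl.

(* The universal property: [b] factors through [tens] by a linear map. *)
Lemma tensor_univ (W : lmodType R[i]) (b : {bilinear E -> F -> W}) :
  exists m : {linear tensor -> W}, forall x y, m (tens x y) = b x y.
Proof.
pose f (t : tensor) := fsum_eval b (repr t).
have fl : linear f by move=> c s t; rewrite /f !evalE.
pose fL := GRing.isLinear.Build R[i] tensor W *:%R f fl.
pose m : {linear tensor -> W} := HB.pack f fL.
exists m => x y.
by rewrite /= /f fsum_eval_repr /fsum_eval big_seq1.
Qed.

End algebraic_tensor.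

Arguments tens {R E F} x y.

Section projective_tensor.
Variables (R : realType) (E F : opSpaceType R).

Definition mxtens p q (v : 'M[E]_p) (w : 'M[F]_q) : 'M[tensor E F]_(p * q) :=
  \matrix_(i, j) tens (v (mxtens_unindex i).1 (mxtens_unindex j).1)
                      (w (mxtens_unindex i).2 (mxtens_unindex j).2).

(* The operator space projective norm on [M_n] of the algebraic tensor
   product: infimum over all factorisations [u = a (v (x) w) b]. *)
Definition projnorm n (u : 'M[tensor E F]_n) : R :=
  inf [set r : R | exists p q (a : 'M[R[i]]_(n, p * q)) (v : 'M[E]_p)
      (w : 'M[F]_q) (b : 'M[R[i]]_(p * q, n)),
    u = mxsandwich a (mxtens v w) b /\
    r = opnorm a * mxnorm v * mxnorm w * opnorm b].

(* [x (x) y |-> b x y] extends to a complete contraction on the completed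
   operator space projective tensor product. The algebraic tensor product is
   dense there and [G] is complete, so this is a bound on the former. *)
Definition extends_cc (G : opSpaceType R) (b : E -> F -> G) :=
  exists m : {linear tensor E F -> G},
    (forall x y, m (tens x y) = b x y) /\
    (forall n (u : 'M[tensor E F]_n), mxnorm (map_mx m u) <= projnorm u).

End projective_tensor.

(* [amul_norm] also follows from [amul_cc]. *)
HB.mixin Record OperatorSpace_isCCAlgebra (R : realType) A
    of OperatorSpace R A := {
  amul : {bilinear A -> A -> A};
  amulA : forall a b c : A, amul a (amul b c) = amul (amul a b) c;
  amul_norm : forall a b : A, `|amul a b| <= `|a| * `|b|;
  amul_cc : extends_cc amul
}.

#[short(type="ccAlgebraType")]
HB.structure Definition CCAlgebra (R : realType) :=
  { A of OperatorSpace_isCCAlgebra R A & OperatorSpace R A }.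

HB.mixin Record OperatorSpace_isCCModule (R : realType) (A : ccAlgebraType R) E
    of OperatorSpace R E := {
  act : {bilinear A -> E -> E};
  actA : forall (a b : A) (x : E), act a (act b x) = act (amul a b) x;
  act_cc : extends_cc act
}.

#[short(type="ccModuleType")]
HB.structure Definition CCModule (R : realType) (A : ccAlgebraType R) :=
  { E of OperatorSpace_isCCModule R A E & OperatorSpace R E }.

Definition module_hom (R : realType) (A : ccAlgebraType R)
    (E F : ccModuleType A) (T : {linear E -> F}) :=
  forall (a : A) (x : E), T (act a x) = act a (T x).

Section dual_space.
Variables (R : realType) (E : normedModType R[i]).

Definition dual_pred : {pred E -> R[i]^o} :=
  fun phi => `[< linear phi /\ continuous (phi : E -> R[i]^o) >].

Record dual := Dual { dual_fun :> E -> R[i]^o; _ : dual_fun \in dual_pred }.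

HB.instance Definition _ := [isSub for dual_fun].
HB.instance Definition _ := [Choice of dual by <:].

Lemma dual_pred_submod : submod_closed dual_pred.
Proof.
split=> [|c f g].
  apply/asboolP; split=> [a x y|]; last exact: cst_continuous.
  by rewrite scaler0 addr0.
move=> /asboolP[fl fc] /asboolP[gl gc]; apply/asboolP; split=> [a x y|x].
  have Efg z : (c *: f + g) z = c *: f z + g z by [].
  rewrite !Efg fl gl !scalerDr !scalerA (mulrC c a) -!addrA; congr (_ + _).
  by rewrite addrCA.
apply: (@cvgD _ R[i]^o); last exact: gc.
by apply: (@cvgZr _ R[i]^o); exact: fc.
Qed.

HB.instance Definition _ := GRing.isSubmodClosed.Build R[i] (E -> R[i]^o)
  dual_pred dual_pred_submod.
HB.instance Definition _ := [SubChoice_isSubLmodule of dual by <:].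

Definition dual_norm (phi : dual) : R :=
  sup [set absc (phi x) | x in [set x : E | `|x| <= 1]].

(* Every bounded functional on the dual is evaluation at a vector. *)
Definition reflexive_space :=
  forall Phi : {linear dual -> R[i]^o},
    (exists M : R, forall phi, absc (Phi phi) <= M * dual_norm phi) ->
    exists x : E, forall phi, Phi phi = phi x.

(* [E] with its weak topology: the coarsest one making every [phi] continuous *)
Definition weak : Type :=
  initial_topology
    ((fun x phi => phi x) : E -> prod_topology (fun _ : dual => R[i]^o)).

End dual_space.

Definition weakly_compact (R : realType) (E F : normedModType R[i])
    (T : E -> F) :=
  precompact (T @` [set x | `|x| <= 1] : set (weak F)).

(* Main.v *)
Require Import Defs.
From HB Require Import structures.
From mathcomp Require Import all_boot all_order all_algebra.
From mathcomp Require Import complex mxtens boolp classical_sets functions reals ereal.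
From mathcomp Require Import topology normedtype.
From mathcomp Require Import ring lra.

(* The interpolation method of Davis, Figiel, Johnson and Pelczynski, carried
   out at all matrix levels. Let c be the cb-norm of T, let w_k = 2^(-(k+1)/2)
   (so that the squares of the w_k sum to 1), and for a matrix x over F let
     K_k x = inf_u (c w_k |u| + 4^k w_k |x - T u|).
   The space G consists of the x in F for which the K_k x are square summable.
   The l^2 norm of (K_k x)_k is not an operator space structure at the higher
   matrix levels, because it fails the axiom for direct sums; G carries the
   largest operator space structure below it, whose norm at level 1 is still
   that l^2 norm. Since K_k (T u) <= c w_k |u|, the map T : E -> G has cb-norm at
   most c. By maximality A acts on G completely contractively, and G -> F is a
   complete contraction because the norms of F are an operator space structure
   below the l^2 norm.

   G is reflexive: the unit ball of G lies in C T(ball E) + e ball F for every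
   e > 0, so weak compactness of T makes every functional on G* coincide on F*
   with a point of F. That point is in G, and F* is dense in G*: a functional on
   G is small on the x of norm at most 1 whose first N coordinates are small. *)

Set Implicit Arguments.
Unset Strict Implicit.
Unset Printing Implicit Defensive.

Import Order.TTheory GRing.Theory Num.Theory.
Import numFieldNormedType.Exports.

Local Open Scope classical_set_scope.
Local Open Scope complex_scope.
Local Open Scope ring_scope.

(** * Moduli, Euclidean norms and operator norms of scalar matrices *)

(** The direct sum axiom asks for maxima, and the l^2 sum of termwise maxima of two sequences can
    exceed the maximum of their l^2 sums. Passing to the largest structure below keeps what the
    proof needs: a map into G, or the action of A on G, is estimated by testing against an arbitrary
    competing structure. Level 1 survives because the minimal structure built on each partial l^2
    sum is a competitor that agrees with it there. The weights have several duties. The factor c on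
    |u| gives w_k |x| <= K_k x, so that the single normalisation of the squares of the w_k makes G
    -> F contractive and bounds the cb-norm of R : E -> G by c; equality with c then follows from
    the factorisation of T. The relative factor 4^k is that of the gauges of 2^k T(ball E) + 2^(-k)
    ball F, and 4^k w_k tends to infinity, which is what brings bounded sets of G close to multiples
    of T(ball E). No series is formed: the l^2 norm occurs only as the supremum of its partial sums,
    and G is a submodule of F rather than of an l^2 sum of spaces. *)

Section modulus.
Variable R : realType.
Implicit Types (z w : R[i]) (r : R).

Lemma absc_norm z : (absc z)%:C = `|z|.
Proof. by rewrite /absc normc_def. Qed.

Lemma absc_sqr z : absc z ^+ 2 = complex.Re z ^+ 2 + complex.Im z ^+ 2.
Proof. by rewrite /absc normc_def /= sqr_sqrtr// addr_ge0// sqr_ge0. Qed.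

Lemma absc_ge0 z : 0 <= absc z.
Proof. by rewrite /absc normc_def /= sqrtr_ge0. Qed.

Lemma absc0 : absc (0 : R[i]) = 0.
Proof. by rewrite /absc normr0. Qed.

Lemma absc1 : absc (1 : R[i]) = 1.
Proof. by rewrite /absc normr1. Qed.

Lemma absc_real r : absc r%:C = `|r|.
Proof. by rewrite /absc normc_def /= expr0n addr0 sqrtr_sqr. Qed.

Lemma abscM z w : absc (z * w) = absc z * absc w.
Proof. by apply: complexI; rewrite rmorphM /= !absc_norm normrM. Qed.

Lemma abscN z : absc (- z) = absc z.
Proof. by rewrite /absc normrN. Qed.

Lemma absc_eq0 z : (absc z == 0) = (z == 0).
Proof.
apply/eqP/eqP => [h|->]; last exact: absc0.
by apply/normr0_eq0; rewrite -absc_norm h.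
Qed.

Lemma abscD z w : absc (z + w) <= absc z + absc w.
Proof. by rewrite -lecR rmorphD /= !absc_norm ler_normD. Qed.

Lemma abscB z w : absc (z - w) = absc (w - z).
Proof. by rewrite -abscN opprB. Qed.

Lemma absc_sum (I : Type) (s : seq I) (P : pred I) (f : I -> R[i]) :
  absc (\sum_(i <- s | P i) f i) <= \sum_(i <- s | P i) absc (f i).
Proof.
elim/big_rec2: _ => [|i y z _ h]; first by rewrite absc0.
by apply: le_trans (abscD _ _) _; rewrite lerD2l.
Qed.

Lemma Re_le_absc z : complex.Re z <= absc z.
Proof.
apply: le_trans (ler_norm _) _.
by rewrite -(@ler_pXn2r _ 2) ?nnegrE ?absc_ge0// absc_sqr real_normK ?num_real//
  lerDl sqr_ge0.
Qed.

Lemma absc_conj z : absc z^* = absc z.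
Proof. by rewrite /absc normcJ. Qed.

(** Reduces bounds on the modulus of a functional to bounds on its real part, on any set stable
    under unimodular scalars. *)
Lemma absc_rotate z : exists2 u : R[i], absc u = 1 & complex.Re (u * z) = absc z.
Proof.
have [->|z0] := eqVneq z 0; first by exists 1; rewrite ?absc1// mulr0 absc0.
have a0 : absc z != 0 by rewrite absc_eq0.
have E : z^* * z = (absc z ^+ 2)%:C.
  by rewrite mulrC -sqr_normc -absc_norm rmorphXn.
exists ((absc z)^-1%:C * z^*).
  by rewrite abscM absc_real absc_conj ger0_norm ?invr_ge0 ?absc_ge0// mulVf.
rewrite -mulrA E -rmorphM /= expr2 mulrA mulVf// mul1r//.
Qed.

Lemma ler_eps (x y : R) : (forall e, 0 < e -> x <= y + e) -> x <= y.
Proof. by move=> h; apply/ler_addgt0Pr. Qed.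

End modulus.

(** * Finite l^2 sums of real numbers *)

Section real_l2.
Variable R : realType.

Section seq_l2.
Variables (I : Type) (s : seq I) (P : pred I).
Implicit Types f g : I -> R.

Definition l2 f : R := Num.sqrt (\sum_(i <- s | P i) f i ^+ 2).

Lemma sum_sqr_ge0 f : 0 <= \sum_(i <- s | P i) f i ^+ 2.
Proof. by apply: sumr_ge0 => i _; exact: sqr_ge0. Qed.

Lemma l2_ge0 f : 0 <= l2 f. Proof. exact: sqrtr_ge0. Qed.

Lemma l2_sqr f : l2 f ^+ 2 = \sum_(i <- s | P i) f i ^+ 2.
Proof. by rewrite sqr_sqrtr// sum_sqr_ge0. Qed.

Lemma sum_sqr_lin f g (a b : R) :
  \sum_(i <- s | P i) (a * f i + b * g i) ^+ 2 =
  a ^+ 2 * (\sum_(i <- s | P i) f i ^+ 2) +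
  2 * a * b * (\sum_(i <- s | P i) f i * g i) +
  b ^+ 2 * (\sum_(i <- s | P i) g i ^+ 2).
Proof.
rewrite !mulr_sumr -!big_split /=; apply: eq_bigr => i _; ring.
Qed.

Lemma l2_CS f g : \sum_(i <- s | P i) f i * g i <= l2 f * l2 g.
Proof.
have [h|h] := ltP (\sum_(i <- s | P i) f i * g i) 0.
  by rewrite (le_trans (ltW h))// mulr_ge0// l2_ge0.
rewrite -(@ler_pXn2r _ 2) ?nnegrE// ?mulr_ge0 ?l2_ge0//.
rewrite exprMn !l2_sqr.
have := sum_sqr_lin f g; have := sum_sqr_ge0 f; have := sum_sqr_ge0 g.
set A := \sum_(i <- s | P i) f i ^+ 2; set B := \sum_(i <- s | P i) g i ^+ 2.
set C := \sum_(i <- s | P i) f i * g i => B0 A0 H.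
(* A nonnegative quadratic form in (a, b): the inequality C^2 <= A B comes from its value at (-C,
   A), or at (B, -C) when A = 0. *)
have H1 a b : 0 <= a ^+ 2 * A + 2 * a * b * C + b ^+ 2 * B.
  by rewrite -H sum_sqr_ge0.
have [a0|] := eqVneq A 0.
  have [b0|b0] := eqVneq B 0.
    by have := H1 C (-1); rewrite a0 b0; nra.
  have {}b0 : 0 < B by rewrite lt_def b0.
  by rewrite -(ler_pM2r b0); have := H1 B (- C); nra.
move=> a0; have {}a0 : 0 < A by rewrite lt_def a0.
by rewrite -(ler_pM2r a0); have := H1 (- C) A; nra.
Qed.

Lemma le_l2 f g : (forall i, P i -> 0 <= f i <= g i) -> l2 f <= l2 g.
Proof.
move=> h; apply: ler_wsqrtr; apply: ler_sum => i /h /andP[f0 fg].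
by rewrite ler_pXn2r// nnegrE (le_trans f0).
Qed.

Lemma l2D f g : l2 (fun i => f i + g i) <= l2 f + l2 g.
Proof.
rewrite -(@ler_pXn2r _ 2) ?nnegrE ?addr_ge0 ?l2_ge0// sqrrD !l2_sqr.
under eq_bigr do rewrite sqrrD.
rewrite 2!big_split /= lerD2r lerD2l.
by rewrite sumrMnl lerMn2r l2_CS orbT.
Qed.

Lemma l2Z (c : R) f : 0 <= c -> l2 (fun i => c * f i) = c * l2 f.
Proof.
move=> c0; rewrite /l2; under eq_bigr do rewrite exprMn.
by rewrite -mulr_sumr sqrtrM ?sqr_ge0// sqrtr_sqr ger0_norm.
Qed.

End seq_l2.

End real_l2.

(** * Operator norms between Euclidean spaces *)

Section euclidean.
Variable R : realType.
Implicit Types (m n p q : nat).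

Lemma l2normE n (x : 'cV[R[i]]_n) :
  l2norm x = l2 (index_enum 'I_n) xpredT (fun i => absc (x i 0)).
Proof. by []. Qed.

Lemma l2norm_ge0 n (x : 'cV[R[i]]_n) : 0 <= l2norm x.
Proof. exact: sqrtr_ge0. Qed.

Lemma l2norm_sqr n (x : 'cV[R[i]]_n) : l2norm x ^+ 2 = \sum_i absc (x i 0) ^+ 2.
Proof. exact: l2_sqr. Qed.

Lemma l2norm0 n : l2norm (0 : 'cV[R[i]]_n) = 0.
Proof.
by rewrite /l2norm big1 ?sqrtr0// => i _; rewrite mxE absc0 expr0n.
Qed.

Lemma l2norm_eq0 n (x : 'cV[R[i]]_n) : l2norm x = 0 -> x = 0.
Proof.
move=> h; have := l2norm_sqr x; rewrite h expr0n /= => /esym/eqP.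
rewrite psumr_eq0; last by move=> i _; exact: sqr_ge0.
move=> /allP H; apply/matrixP => i j; rewrite ord1 mxE.
by have /= := H i (mem_index_enum i); rewrite sqrf_eq0 absc_eq0 => /eqP.
Qed.

Lemma l2normZ n (c : R[i]) (x : 'cV[R[i]]_n) :
  l2norm (c *: x) = absc c * l2norm x.
Proof.
rewrite !l2normE -l2Z ?absc_ge0//; congr Num.sqrt.
by apply: eq_bigr => i _; rewrite !mxE abscM.
Qed.

Lemma l2norm_CS n (x y : 'cV[R[i]]_n) :
  absc (\sum_i x i 0 * y i 0) <= l2norm x * l2norm y.
Proof.
apply: le_trans (absc_sum _ _ _) _; rewrite !l2normE.
by under eq_bigr do rewrite abscM; exact: l2_CS.
Qed.

Lemma l2norm_conj n (x : 'cV[R[i]]_n) : l2norm (map_mx conjc x) = l2norm x.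
Proof.
by rewrite /l2norm; congr Num.sqrt; apply: eq_bigr => i _; rewrite mxE absc_conj.
Qed.

Lemma l2norm_col_mx m n (x : 'cV[R[i]]_m) (y : 'cV[R[i]]_n) :
  l2norm (col_mx x y) ^+ 2 = l2norm x ^+ 2 + l2norm y ^+ 2.
Proof.
rewrite !l2norm_sqr big_split_ord /=.
by congr (_ + _); apply: eq_bigr => i _; rewrite ?col_mxEu ?col_mxEd.
Qed.

(** Cauchy-Schwarz on each row yields the Hilbert-Schmidt norm as [C]. Only its existence matters:
    the [sup] in [opnorm] is meaningful once the set has an upper bound. *)
Lemma l2norm_bounded m n (a : 'M[R[i]]_(m, n)) :
  exists2 C, 0 <= C & forall x, l2norm (a *m x) <= C * l2norm x.
Proof.
pose C i := l2norm (\col_j a i j).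
exists (l2 (index_enum 'I_m) xpredT C); first exact: l2_ge0.
move=> x; rewrite l2normE mulrC -l2Z ?l2norm_ge0//.
apply: le_l2 => i _; rewrite absc_ge0 /= mulrC.
have -> : (a *m x) i 0 = \sum_j (\col_j a i j) j 0 * x j 0.
  by rewrite mxE; apply: eq_bigr => j _; rewrite mxE.
exact: l2norm_CS.
Qed.

Lemma opnorm_ubound m n (a : 'M[R[i]]_(m, n)) :
  has_ubound [set l2norm (a *m x) | x in [set x | l2norm x <= 1]].
Proof.
have [C C0 h] := l2norm_bounded a; exists C => _ /= [x x1 <-].
by apply: le_trans (h x) _; rewrite ler_piMr.
Qed.

Lemma opnorm_ge0 m n (a : 'M[R[i]]_(m, n)) : 0 <= opnorm a.
Proof.
apply: (@le_trans _ _ (l2norm (a *m 0))); first exact: l2norm_ge0.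
by apply: ub_le_sup; [exact: opnorm_ubound|exists 0; rewrite //= l2norm0].
Qed.

Lemma l2norm_mulmx m n (a : 'M[R[i]]_(m, n)) x :
  l2norm (a *m x) <= opnorm a * l2norm x.
Proof.
have [/l2norm_eq0 ->|x0] := eqVneq (l2norm x) 0.
  by rewrite mulmx0 !l2norm0 mulr0.
have {x0} x0 : 0 < l2norm x by rewrite lt_def x0 l2norm_ge0.
rewrite -ler_pdivrMr//.
have -> : l2norm (a *m x) / l2norm x = l2norm (a *m ((l2norm x)^-1%:C *: x)).
  by rewrite -scalemxAr l2normZ absc_real gtr0_norm ?invr_gt0// mulrC.
apply: ub_le_sup; first exact: opnorm_ubound.
exists ((l2norm x)^-1%:C *: x) => //=.
by rewrite l2normZ absc_real gtr0_norm ?invr_gt0// mulVf// gt_eqF.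
Qed.

Lemma opnorm_le m n (a : 'M[R[i]]_(m, n)) (C : R) :
  0 <= C -> (forall x, l2norm (a *m x) <= C * l2norm x) -> opnorm a <= C.
Proof.
move=> C0 h; apply: ge_sup; first by exists (l2norm (a *m 0)), 0; rewrite //= l2norm0.
by move=> _ /= [x x1 <-]; apply: le_trans (h x) _; rewrite ler_piMr.
Qed.

Lemma opnorm_scalar n (c : R[i]) : opnorm (c%:M : 'M_n) <= absc c.
Proof.
by apply: opnorm_le => [|x]; rewrite ?absc_ge0// mul_scalar_mx l2normZ.
Qed.

Lemma opnorm1 n : opnorm (1%:M : 'M[R[i]]_n) <= 1.
Proof. by apply: le_trans (opnorm_scalar _ _) _; rewrite absc1. Qed.

Lemma opnorm_tr_le m n (a : 'M[R[i]]_(m, n)) : opnorm a^T <= opnorm a.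
Proof.
apply: opnorm_le => [|x]; first exact: opnorm_ge0.
set y := a^T *m x.
have [->|y0] := eqVneq (l2norm y) 0.
  by rewrite mulr_ge0 ?opnorm_ge0 ?l2norm_ge0.
have {}y0 : 0 < l2norm y by rewrite lt_def y0 l2norm_ge0.
rewrite -(ler_pM2r y0) -expr2.
(* The pairing of columns is bilinear, so the conjugate is put in by hand: pairing [x] with [a *m z]
   gives the sum of the y_j times their conjugates. *)
pose z := map_mx conjc y.
have -> : l2norm y ^+ 2 = absc (\sum_i x i 0 * (a *m z) i 0).
  have -> : \sum_i x i 0 * (a *m z) i 0 = ((l2norm y) ^+ 2)%:C.
    rewrite l2norm_sqr rmorph_sum /=.
    under eq_bigr do rewrite mxE mulr_sumr.
    rewrite exchange_big /=; apply: eq_bigr => j _.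
    rewrite rmorphXn /= absc_norm sqr_normc [in X in _ = X * _]mxE mulr_suml.
    by apply: eq_bigr => i _; rewrite !mxE; ring.
  by rewrite absc_real ger0_norm// sqr_ge0.
apply: le_trans (l2norm_CS _ _) _; rewrite (mulrC (opnorm a)) -mulrA ler_wpM2l ?l2norm_ge0//.
by apply: le_trans (l2norm_mulmx _ _) _; rewrite l2norm_conj.
Qed.

Lemma opnorm_tr m n (a : 'M[R[i]]_(m, n)) : opnorm a^T = opnorm a.
Proof. by apply/le_anti; rewrite opnorm_tr_le -{1}(trmxK a) opnorm_tr_le. Qed.

Lemma opnorm_col n (x : 'cV[R[i]]_n) : opnorm x <= l2norm x.
Proof.
apply: opnorm_le => [|y]; first exact: l2norm_ge0.
have -> : x *m y = y 0 0 *: x.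
  by apply/matrixP => i j; rewrite !mxE big_ord1 mulrC (ord1 j).
by rewrite l2normZ mulrC [in leRHS]/l2norm big_ord1 sqrtr_sqr ger0_norm ?absc_ge0.
Qed.

Lemma opnorm_colT n (x : 'cV[R[i]]_n) : opnorm x^T <= l2norm x.
Proof. by rewrite opnorm_tr opnorm_col. Qed.

Lemma l2norm_delta n (i : 'I_n) : l2norm (delta_mx i 0 : 'cV[R[i]]_n) = 1.
Proof.
rewrite /l2norm (bigD1 i)//= big1 => [|j ji]; last first.
  by rewrite mxE (negbTE ji) absc0 expr0n.
by rewrite mxE !eqxx absc1 expr1n addr0 sqrtr1.
Qed.

Lemma opnorm_col_mx01 m n : opnorm (col_mx 1%:M 0 : 'M[R[i]]_(m + n, m)) <= 1.
Proof.
apply: opnorm_le => // x; rewrite mul1r mul_col_mx mul1mx mul0mx.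
rewrite -(@ler_pXn2r _ 2) ?nnegrE ?l2norm_ge0// l2norm_col_mx l2norm0.
by rewrite expr0n addr0.
Qed.

Lemma opnorm_col_mx10 m n : opnorm (col_mx 0 1%:M : 'M[R[i]]_(n + m, m)) <= 1.
Proof.
apply: opnorm_le => // x; rewrite mul1r mul_col_mx mul1mx mul0mx.
rewrite -(@ler_pXn2r _ 2) ?nnegrE ?l2norm_ge0// l2norm_col_mx l2norm0.
by rewrite expr0n add0r.
Qed.

Lemma opnorm_row_mx01 m n : opnorm (row_mx 1%:M 0 : 'M[R[i]]_(m, m + n)) <= 1.
Proof. by rewrite -opnorm_tr tr_row_mx trmx1 trmx0 opnorm_col_mx01. Qed.

Lemma opnorm_row_mx10 m n : opnorm (row_mx 0 1%:M : 'M[R[i]]_(m, n + m)) <= 1.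
Proof. by rewrite -opnorm_tr tr_row_mx trmx1 trmx0 opnorm_col_mx10. Qed.

End euclidean.

(** * Hahn-Banach and Helly theorems *)

Section hahn_banach.
Variables (R : realType) (V : lmodType R[i]).
Implicit Types (p q f : V -> R) (x y z : V).

Definition sublinear q :=
  (forall x y, q (x + y) <= q x + q y) /\
  (forall (t : R) x, 0 <= t -> q (t%:C *: x) = t * q x).

Lemma sublinear0 q : sublinear q -> q 0 = 0.
Proof. by move=> [_ h]; have := h 0 0 (lexx _); rewrite scaler0 mul0r. Qed.

Lemma sublinearN q x : sublinear q -> - q (- x) <= q x.
Proof.
move=> hq; have := hq.1 x (- x); rewrite subrr (sublinear0 hq) => h.
by rewrite -subr_ge0 opprK.
Qed.

Lemma sublinear_minimal q : sublinear q -> exists2 f,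
  sublinear f /\ (forall x, f x <= q x) &
  forall p, sublinear p -> (forall x, p x <= f x) -> p = f.
Proof.
move=> hq; pose T := {p : V -> R | sublinear p /\ forall x, p x <= q x}.
(* The order is reversed, so that the maximal element given by Zorn's lemma is a minimal
   functional. *)
pose le (a b : T) : bool := `[< forall x, sval b x <= sval a x >].
have [| | |A Atot|[f [fs fq]] fmin] := @Zorn T le.
- by move=> [p ?]; apply/asboolP.
- by move=> a b c /asboolP h1 /asboolP h2; apply/asboolP => x; apply: le_trans (h1 x).
- move=> [a ha] [b hb] /asboolP h1 /asboolP h2; apply: eq_exist => /=.
  by apply/funext => x; apply/le_anti; rewrite h2 h1.
- have [[a0 Aa0]|A0] := pselect (exists a, A a); last first.
    have hq' : sublinear q /\ forall x, q x <= q x by [].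
    by exists (exist _ q hq') => s As; case: A0; exists s.
  pose inf_ x := inf [set sval a x | a in A].
  have lb x : has_lbound [set sval a x | a in A].
    exists (- q (- x)) => _ [[a [ha haq]] Aa <-] /=.
    by apply: le_trans (sublinearN x ha); rewrite lerN2.
  have le_inf a x : A a -> inf_ x <= sval a x by move=> Aa; apply: ge_inf => //; exists a.
  have inf_le x r : (forall a, A a -> r <= sval a x) -> r <= inf_ x.
    move=> h; apply: lb_le_inf; first by exists (sval a0 x), a0.
    by move=> _ [a Aa <-]; exact: h.
  have hs : sublinear inf_ /\ forall x, inf_ x <= q x.
    split=> [|x]; last by apply: le_trans (le_inf _ x Aa0) _; exact: (svalP a0).2.
    split=> [x y|t x t0].
      (* Subadditivity of the infimum uses the chain condition: the smaller of [a] and [b] bounds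
         [inf_] at x + y and lies below both. *)
      rewrite -lerBlDr; apply: (inf_le) => a Aa.
      rewrite lerBlDr -lerBlDl; apply: (inf_le) => b Ab; rewrite lerBlDl.
      have [/asboolP h|/asboolP h] := Atot _ _ Aa Ab.
        apply: le_trans (le_inf _ _ Ab) _; apply: le_trans ((svalP b).1.1 _ _) _.
        by rewrite lerD2r.
      apply: le_trans (le_inf _ _ Aa) _; apply: le_trans ((svalP a).1.1 _ _) _.
      by rewrite lerD2l.
    move: t0; rewrite le_eqVlt => /predU1P[<-|t0].
      rewrite mul0r scale0r; apply/le_anti/andP; split.
        by apply: le_trans (le_inf _ _ Aa0) _; rewrite (sublinear0 (svalP a0).1).
      by apply: (inf_le) => a Aa; rewrite (sublinear0 (svalP a).1).
    apply/le_anti/andP; split.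
      rewrite -ler_pdivrMl//; apply: (inf_le) => a Aa; rewrite ler_pdivrMl//.
      by rewrite -((svalP a).1.2 _ _ (ltW t0)); exact: le_inf.
    by apply: (inf_le) => a Aa; rewrite ((svalP a).1.2 _ _ (ltW t0)) ler_pM2l//; exact: le_inf.
  by exists (exist _ inf_ hs) => s As; apply/asboolP => x; exact: le_inf.
exists f => // p ps pf.
have h : sublinear p /\ forall x, p x <= q x.
  by split=> // x; apply: le_trans (fq x).
suff E : exist _ p h = exist _ f (conj fs fq) :> T by exact: (congr1 sval E).
by apply: fmin; apply/asboolP.
Qed.

(** The witness is the infimum over t >= 0 of q (x + t y) - t q y; t = 0 and t = 1 give the two
    bounds. At x = -y the second bound is p (-y) <= - q y, which forces a linear functional below
    [p] to reach [q] at [y]. *)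
Lemma sublinear_slope q y : sublinear q -> exists2 p, sublinear p &
  (forall x, p x <= q x) /\ forall x, p x <= q (x + y) - q y.
Proof.
move=> hq.
pose S x := [set q (x + t%:C *: y) - t * q y | t in [set t : R | 0 <= t]].
have lb x r : S x r -> - q (- x) <= r.
  move=> [t /= t0 <-]; rewrite lerBrDr addrC -lerBrDr opprK -hq.2//.
  by have := hq.1 (x + t%:C *: y) (- x); rewrite addrAC subrr add0r.
have Slb x : has_lbound (S x) by exists (- q (- x)) => r; exact: lb.
have p_le x t : 0 <= t -> inf (S x) <= q (x + t%:C *: y) - t * q y.
  by move=> t0; apply: ge_inf => //; exists t.
have le_p x r : (forall t, 0 <= t -> r <= q (x + t%:C *: y) - t * q y) -> r <= inf (S x).
  move=> h; apply: lb_le_inf; first by exists (q (x + 0%:C *: y) - 0 * q y), 0 => /=.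
  by move=> _ [t t0 <-]; exact: h.
exists (fun x => inf (S x)); last first.
  split=> x; first by apply: le_trans (p_le x 0 _) _; rewrite // scale0r addr0 mul0r subr0.
  by apply: le_trans (p_le x 1 _) _; rewrite // scale1r mul1r.
split=> [x z|t x].
  rewrite -lerBlDr; apply: (le_p x) => s s0.
  rewrite lerBlDr -lerBlDl; apply: (le_p z) => t t0; rewrite lerBlDl.
  apply: le_trans (p_le _ (s + t) (addr_ge0 s0 t0)) _.
  rewrite rmorphD /= scalerDl addrACA mulrDl opprD [leRHS]addrACA lerD2r.
  exact: hq.1.
rewrite le_eqVlt => /predU1P[<-|t0].
  rewrite scale0r mul0r; apply/le_anti/andP; split.
    by apply: le_trans (p_le _ 0 _) _; rewrite // scale0r addr0 mul0r subr0 (sublinear0 hq).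
  by apply: (le_p) => s s0; rewrite add0r hq.2// subrr.
apply/le_anti/andP; split.
  rewrite -ler_pdivrMl//; apply: (le_p) => s s0; rewrite ler_pdivrMl//.
  apply: le_trans (p_le _ (t * s) _) _; first by rewrite mulr_ge0// ltW.
  by rewrite rmorphM /= -scalerA -scalerDr (hq.2 _ _ (ltW t0)) mulrBr mulrA.
apply: (le_p) => s s0.
have -> : s = t * (s / t) by rewrite mulrCA mulfV ?mulr1// gt_eqF.
rewrite rmorphM /= -scalerA -scalerDr (hq.2 _ _ (ltW t0)) -mulrA -mulrBr ler_pM2l//.
by apply: p_le; rewrite divr_ge0// ltW.
Qed.

(* A minimal sublinear functional is linear, since it must coincide with the
   smaller ones that [sublinear_slope] derives from it. *)
Lemma hahn_banach_real q y : sublinear q -> exists f,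
  [/\ forall x z, f (x + z) = f x + f z, forall (t : R) x, f (t%:C *: x) = t * f x,
      forall x, f x <= q x & f y = q y].
Proof.
move=> hq; have [p hp [pq py]] := sublinear_slope y hq.
have [f [fs fp] fmin] := sublinear_minimal hp.
have fD x z : f (x + z) = f x + f z.
  apply/le_anti; rewrite fs.1 /=.
  have [g gs [gf gz]] := sublinear_slope z fs.
  by have := gz x; rewrite (fmin g gs gf) lerBrDr.
have fN x : f (- x) = - f x.
  by apply/eqP; rewrite -addr_eq0 -fD addNr (sublinear0 fs).
exists f; split=> // [t x|x|].
- have [t0|/ltW t0] := leP 0 t; first exact: fs.2.
  rewrite -[t]opprK rmorphN /= scaleNr fN fs.2 ?oppr_ge0//.
  by rewrite !mulNr !opprK.
- exact: le_trans (pq x).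
- apply/le_anti; rewrite (le_trans (fp y) (pq y)) /=.
  rewrite -[f y]opprK -fN lerNr.
  apply: le_trans (fp _) _; apply: le_trans (py _) _.
  by rewrite addNr (sublinear0 hq) add0r.
Qed.

Lemma hahn_banach_complex q y : sublinear q -> exists g : {linear V -> R[i]^o},
  (forall x, complex.Re (g x) <= q x) /\ complex.Re (g y) = q y.
Proof.
move=> hq; have [f [fD fZ fq fy]] := hahn_banach_real y hq.
pose g x : R[i]^o := f x -i* f ('i *: x).
have gl : linear g.
  move=> [a b] x z; rewrite /g.
  have E w : (a +i* b) *: w = a%:C *: w + b%:C *: ('i *: w).
    by rewrite scalerA -scalerDl; congr (_ *: _); apply/eqP;
      rewrite eq_complex /=; apply/andP; split; apply/eqP; ring.
  have E2 w : 'i *: ((a +i* b) *: w) = a%:C *: ('i *: w) - b%:C *: w.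
    rewrite !scalerA -scaleNr -scalerDl; congr (_ *: _).
    by apply/eqP; rewrite eq_complex /=; apply/andP; split; apply/eqP; ring.
  rewrite scalerDr E2 E !fD !fZ -scaleNr -rmorphN /= fZ.
  by apply/eqP; rewrite eq_complex /=; apply/andP; split; apply/eqP; ring.
pose gL := GRing.isLinear.Build R[i] V R[i]^o *:%R g gl.
exists (HB.pack g gL : {linear V -> R[i]^o}); split => //=.
Qed.

Definition seminorm q :=
  (forall x y, q (x + y) <= q x + q y) /\ (forall c x, q (c *: x) = absc c * q x).

Lemma seminorm_sublinear q : seminorm q -> sublinear q.
Proof.
move=> [qD qZ]; split=> // t x t0.
by rewrite qZ absc_real ger0_norm.
Qed.

Lemma linear_absc_le (g : {linear V -> R[i]^o}) q :
  (forall x c, absc c = 1 -> q (c *: x) = q x) ->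
  (forall x, complex.Re (g x) <= q x) -> forall x, absc (g x) <= q x.
Proof.
move=> qu gq x; have [u u1 <-] := absc_rotate (g x).
by rewrite -(qu x u u1); have := gq (u *: x); rewrite linearZ.
Qed.

Lemma hahn_banach_norming q y : seminorm q -> exists g : {linear V -> R[i]^o},
  (forall x, absc (g x) <= q x) /\ g y = (q y)%:C.
Proof.
move=> hq; have [g [gq gy]] := hahn_banach_complex y (seminorm_sublinear hq).
have gq' : forall x, absc (g x) <= q x.
  by apply: linear_absc_le => // x c c1; rewrite hq.2 c1 mul1r.
exists g; split => //.
(* The real part of [g y] already equals [q y], which bounds the modulus; hence the imaginary part
   vanishes. *)
have h := gq' y; have q0 : 0 <= q y by apply: le_trans h; exact: absc_ge0.
have := absc_sqr (g y); rewrite gy => E.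
have I0 : complex.Im (g y) = 0.
  apply/eqP; rewrite -sqrf_eq0; apply/eqP/le_anti; rewrite sqr_ge0 andbT.
  by rewrite -(lerD2l (q y ^+ 2)) -E addr0 ler_pXn2r ?nnegrE ?absc_ge0.
by apply/eqP; rewrite eq_complex /= gy I0 !eqxx.
Qed.

End hahn_banach.

Section helly.
Variables (R : realType) (V : lmodType R[i]) (B : set V).
Hypotheses (B0 : B !=set0)
  (Bconv : forall (t : R) x y, 0 <= t <= 1 -> B x -> B y -> B (x + t%:C *: (y - x)))
  (Bbal : forall c x, absc c = 1 -> B x -> B (c *: x)).
Variables (n : nat) (f : 'I_n -> {linear V -> R[i]^o}) (b : 'I_n -> R[i]).
Hypothesis (fB : forall i, exists M, forall x, B x -> absc (f i x) <= M).
Hypothesis (Hb : forall (c : 'I_n -> R[i]) (r : R),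
  (forall x, B x -> absc (\sum_i c i * f i x) <= r) -> absc (\sum_i c i * b i) <= r).

(* Otherwise an almost nearest point [y] of [f @` B] to [b] yields, as in the
   proof of the projection theorem, a functional [c] separating [b] from it. *)
Lemma helly (d : R) : 0 < d ->
  exists2 x, B x & forall i, absc (f i x - b i) <= d.
Proof.
move=> d0; apply: contrapT => noB.
pose N x := \sum_i absc (f i x - b i) ^+ 2.
have N_ge x : B x -> d ^+ 2 <= N x.
  move=> Bx; rewrite leNgt; apply/negP => Nx; apply: noB; exists x => // i.
  rewrite -(@ler_pXn2r _ 2) ?nnegrE ?absc_ge0 ?(ltW d0)//.
  apply: le_trans (ltW Nx); rewrite /N (bigD1 i)//= lerDl.
  by apply: sumr_ge0 => *; exact: sqr_ge0.
have [M HM] := choice fB.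
pose S := \sum_i (2 * M i) ^+ 2.
have S0 : 0 <= S by apply: sumr_ge0 => *; exact: sqr_ge0.
have D0 x y : B x -> B y -> \sum_i absc (f i x - f i y) ^+ 2 <= S.
  move=> Bx By; apply: ler_sum => i _.
  have M0 : 0 <= M i by apply: le_trans (HM i x Bx); exact: absc_ge0.
  rewrite ler_pXn2r ?nnegrE ?absc_ge0 ?mulr_ge0//.
  apply: le_trans (abscD _ _) _; rewrite abscN mulr_natl mulr2n.
  by apply: lerD; exact: HM.
(* [t <= 1] keeps the segment from [y] inside [B]; [t * (1 + S) <= d ^+ 2] makes the error of the
   separation smaller than the gap. *)
pose t := Num.min 1 (d ^+ 2 / (1 + S)).
have S1 : 0 < 1 + S by rewrite ltr_wpDr.
have t0 : 0 < t by rewrite lt_min ltr01 divr_gt0// exprn_gt0.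
have t1 : t <= 1 by rewrite ge_min lexx.
have td : t * (1 + S) <= d ^+ 2.
  by rewrite -ler_pdivlMr// ge_min lexx orbT.
pose I := inf [set N x | x in B].
have Ilb : has_lbound [set N x | x in B].
  by exists 0 => _ [x _ <-]; apply: sumr_ge0 => *; exact: sqr_ge0.
have [||_ [y By <-] Ny] := @inf_adherent _ [set N x | x in B] (t ^+ 2).
- by rewrite exprn_gt0.
- split=> //; case: B0 => x Bx; by exists (N x), x.
pose c i := (b i - f i y)^*.
(* Since N y < I + t^2, moving from [y] towards [x] by the fraction [t] can lower [N] by less than
   t^2. Expanding the square and dividing by 2t gives the bound. *)
have key x : B x -> complex.Re (\sum_i c i * (f i x - f i y)) <= t * (1 + S) / 2.
  move=> Bx; have Bz : B (y + t%:C *: (x - y)) by apply: Bconv; rewrite ?(ltW t0).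
  have Nz : N (y + t%:C *: (x - y)) = N y
      - 2 * t * complex.Re (\sum_i c i * (f i x - f i y))
      + t ^+ 2 * \sum_i absc (f i x - f i y) ^+ 2.
    rewrite (raddf_sum (@complex.Re R : {additive Rcomplex R -> R})) !mulr_sumr.
    rewrite -sumrB -big_split /=; apply: eq_bigr => i _.
    rewrite linearD linearZ /= linearB /= /c !absc_sqr.
    case: (f i x) => x1 x2; case: (f i y) => y1 y2; case: (b i) => b1 b2 /=.
    ring.
  have : I <= N (y + t%:C *: (x - y)).
    by apply: ge_inf => //; exists (y + t%:C *: (x - y)).
  rewrite Nz; have := Ny; rewrite -/I; have := D0 _ _ Bx By.
  set X := complex.Re _; set Y := \sum_i _ => h1 h2 h3.
  have h4 : t ^+ 2 * Y <= t ^+ 2 * S by rewrite ler_pM2l// exprn_gt0.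
  have : 2 * t * X <= t * (t * (1 + S)) by nra.
  by move=> h5; rewrite -(ler_pM2l t0); lra.
pose r := complex.Re (\sum_i c i * f i y) + t * (1 + S) / 2.
have : absc (\sum_i c i * b i) <= r.
  apply: Hb => x Bx; have [u u1 <-] := absc_rotate (\sum_i c i * f i x).
  have := key (u *: x) (Bbal u1 Bx).
  under eq_bigr do rewrite mulrBr.
  rewrite sumrB raddfB /= lerBlDl -/r.
  have -> // : \sum_i c i * f i (u *: x) = u * \sum_i c i * f i x.
  by rewrite mulr_sumr; apply: eq_bigr => i _; rewrite linearZ /= /GRing.scale /=; ring.
move=> /(le_trans (Re_le_absc _)); rewrite /r -lerBlDl -raddfB /= -sumrB.
(* The result is N y <= t (1 + S) / 2 <= d^2 / 2, against N y >= d^2. *)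
have -> : complex.Re (\sum_i (c i * b i - c i * f i y)) = N y.
  rewrite (raddf_sum (@complex.Re R : {additive Rcomplex R -> R})).
  apply: eq_bigr => i _; rewrite /c absc_sqr.
  by case: (f i y) => y1 y2; case: (b i) => b1 b2 /=; ring.
move=> h; have := N_ge _ By; have : 0 < d ^+ 2 by rewrite exprn_gt0.
by nra.
Qed.

End helly.

(** * Duals and weak topologies *)

Section normed.
Variables (R : realType) (V : normedModType R[i]).
Implicit Types (x y : V) (phi : dual V).

Definition rnorm x : R := complex.Re `|x|.

Lemma rnormC x : (rnorm x)%:C = `|x|.
Proof. by rewrite /rnorm RRe_real// ger0_real. Qed.

Lemma rnorm_ge0 x : 0 <= rnorm x.
Proof. by rewrite -ler0c rnormC. Qed.

Lemma rnorm_le x (r : R) : (rnorm x <= r) = (`|x| <= r%:C).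
Proof. by rewrite -rnormC lecR. Qed.

Lemma rnorm_seminorm : seminorm rnorm.
Proof.
split=> [x y|c x]; first by rewrite rnorm_le rmorphD /= !rnormC ler_normD.
by apply: complexI; rewrite rmorphM /= absc_norm !rnormC normrZ.
Qed.

Lemma rnormD x y : rnorm (x + y) <= rnorm x + rnorm y.
Proof. exact: rnorm_seminorm.1. Qed.

Lemma rnormZ c x : rnorm (c *: x) = absc c * rnorm x.
Proof. exact: rnorm_seminorm.2. Qed.

Lemma rnorm0 : rnorm 0 = 0.
Proof. by rewrite /rnorm normr0. Qed.

Lemma rnormN x : rnorm (- x) = rnorm x.
Proof. by rewrite /rnorm normrN. Qed.

Lemma rnorm_eq0 x : rnorm x = 0 -> x = 0.
Proof. by move=> h; apply/normr0_eq0; rewrite -rnormC h. Qed.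

Lemma rnbhsP x (A : set V) : nbhs x A <->
  exists2 e : R, 0 < e & forall y, rnorm (x - y) < e -> A y.
Proof.
split=> [/nbhs_normP[e /= e0 h]|[e e0 h]].
  have eE : e = (complex.Re e)%:C by rewrite RRe_real// gtr0_real.
  exists (complex.Re e); first by rewrite -ltcR -eE.
  by move=> y; rewrite -ltcR -eE rnormC => /h.
apply/nbhs_normP; exists e%:C; first by rewrite /= ltcR.
by move=> y /=; rewrite -rnormC ltcR => /h.
Qed.

End normed.

Section dual.
Variables (R : realType) (V : normedModType R[i]).
Implicit Types (x y : V) (phi : dual V).

Lemma linear_continuousP (f : {linear V -> R[i]^o}) :
  continuous (f : V -> R[i]^o) <-> exists C, forall x, absc (f x) <= C * rnorm x.
Proof.
split=> [fc|[C h] x].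
  have /fc/rnbhsP[e e0 h] : nbhs (f 0) [set z : R[i]^o | absc z < 1].
    apply/rnbhsP; exists 1 => // y; rewrite linear0 sub0r => hy /=.
    by rewrite -abscN.
  exists (2 / e) => x; have [->|x0] := eqVneq x 0.
    by rewrite linear0 absc0 rnorm0 mulr0.
  have {}x0 : 0 < rnorm x.
    by rewrite lt_def rnorm_ge0 andbT; apply: contra_neq x0; exact: rnorm_eq0.
  pose t := e / (2 * rnorm x); have t0 : 0 < t by rewrite divr_gt0// mulr_gt0.
  have /= := h (t%:C *: x); rewrite sub0r rnormN rnormZ linearZ /= abscM absc_real gtr0_norm//.
  have -> : t * rnorm x = e / 2.
    by rewrite /t invfM mulrA mulfVK// gt_eqF.
  have e2 : e / 2 < e by lra.
  by move=> /(_ e2)/ltW; rewrite -ler_pdivlMl// mulr1 /t invf_div mulrAC.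
move=> A /rnbhsP[e e0 hA]; apply/rnbhsP.
exists (e / (1 + `|C|)); first by rewrite divr_gt0// ltr_pwDl.
move=> y; rewrite ltr_pdivlMr ?ltr_pwDl// => hy; apply: hA.
rewrite -linearB /=; apply: le_lt_trans hy.
apply: le_trans (h _) _; rewrite mulrC ler_wpM2l ?rnorm_ge0//.
by apply: le_trans (ler_norm C) _; rewrite lerDr.
Qed.

Lemma dual_linear phi : linear phi.
Proof. by case: phi => f /= /asboolP[]. Qed.

Lemma dual_continuous phi : continuous (phi : V -> R[i]^o).
Proof. by case: phi => f /= /asboolP[]. Qed.

Definition dual_lin phi : {linear V -> R[i]^o} :=
  HB.pack (phi : V -> R[i]^o)
    (GRing.isLinear.Build R[i] V R[i]^o *:%R phi (dual_linear phi)).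

Lemma dualD phi x y : phi (x + y) = phi x + phi y.
Proof. exact: (linearD (dual_lin phi)). Qed.

Lemma dualB phi x y : phi (x - y) = phi x - phi y.
Proof. exact: (linearB (dual_lin phi)). Qed.

Lemma dualZ phi c x : phi (c *: x) = c * phi x.
Proof. by rewrite -[LHS]/(dual_lin phi (c *: x)) linearZ. Qed.

Lemma dual0 phi : phi 0 = 0.
Proof. exact: (linear0 (dual_lin phi)). Qed.

Lemma dual_of_linear (f : {linear V -> R[i]^o}) (C : R) :
  (forall x, absc (f x) <= C * rnorm x) -> exists phi : dual V, forall x, phi x = f x.
Proof.
move=> h; have fP : (f : V -> R[i]^o) \in dual_pred (E := V).
  apply/asboolP; split; first exact: linearP.
  by apply/linear_continuousP; exists C.
by exists (Dual fP).
Qed.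

Lemma dual_bounded phi : exists C, forall x, absc (phi x) <= C * rnorm x.
Proof. by apply/(linear_continuousP (dual_lin phi)); exact: dual_continuous. Qed.

Lemma dual_norm_ubound phi :
  has_ubound [set absc (phi x) | x in [set x : V | `|x| <= 1]].
Proof.
have [C h] := dual_bounded phi; exists `|C| => _ [x /= x1 <-].
apply: le_trans (h x) _; apply: le_trans (ler_wpM2r (rnorm_ge0 _) (ler_norm C)) _.
by rewrite ler_piMr// rnorm_le.
Qed.

Lemma dual_norm_ge0 phi : 0 <= dual_norm phi.
Proof.
apply: (@le_trans _ _ (absc (phi 0))); first exact: absc_ge0.
by apply: ub_le_sup; [exact: dual_norm_ubound|exists 0; rewrite //= normr0].
Qed.

Lemma dual_normP phi x : absc (phi x) <= dual_norm phi * rnorm x.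
Proof.
have [->|x0] := eqVneq x 0; first by rewrite dual0 absc0 rnorm0 mulr0.
have {}x0 : 0 < rnorm x.
  by rewrite lt_def rnorm_ge0 andbT; apply: contra_neq x0; exact: rnorm_eq0.
rewrite -ler_pdivrMr//.
apply: ub_le_sup; first exact: dual_norm_ubound.
exists ((rnorm x)^-1%:C *: x) => /=.
  by rewrite -rnorm_le rnormZ absc_real gtr0_norm ?invr_gt0// mulVf// gt_eqF.
by rewrite dualZ abscM absc_real gtr0_norm ?invr_gt0// mulrC.
Qed.

Lemma dual_norm_le phi (C : R) : 0 <= C ->
  (forall x, absc (phi x) <= C * rnorm x) -> dual_norm phi <= C.
Proof.
move=> C0 h; apply: ge_sup; first by exists (absc (phi 0)), 0; rewrite //= normr0.
move=> _ [x /= x1 <-]; apply: le_trans (h x) _.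
by rewrite ler_piMr// rnorm_le.
Qed.

Lemma dual_norming x : exists phi : dual V,
  (forall y, absc (phi y) <= rnorm y) /\ phi x = (rnorm x)%:C.
Proof.
have [g [gr gx]] := hahn_banach_norming x (rnorm_seminorm V).
have [|phi hphi] := @dual_of_linear g 1; first by move=> y; rewrite mul1r.
by exists phi; split=> [y|]; rewrite hphi.
Qed.

Lemma rnorm_le_dual x (C : R) :
  (forall phi, absc (phi x) <= C * dual_norm phi) -> 0 <= C -> rnorm x <= C.
Proof.
move=> h C0; have [phi [p1 px]] := dual_norming x.
have := h phi; rewrite px absc_real ger0_norm ?rnorm_ge0// => /le_trans; apply.
by rewrite ler_piMr// dual_norm_le// => y; rewrite mul1r.
Qed.

End dual.

Section weak_topology.
Variables (R : realType) (V : normedModType R[i]).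

Lemma weak_continuous (phi : dual V) : continuous (phi : weak V -> R[i]^o).
Proof.
move=> x; apply: (@continuous_comp (weak V) (prod_topology (fun _ : dual V => R[i]^o))
  R[i]^o (fun x phi => phi x) (fun g => g phi) x).
  exact: initial_continuous.
exact: (@proj_continuous (dual V) (fun _ => R[i]^o) phi).
Qed.

Lemma weak_nbhs (phi : dual V) (x : weak V) (e : R) : 0 < e ->
  nbhs x [set y : weak V | absc (phi x - phi y) < e].
Proof.
move=> e0; apply: (@weak_continuous phi x [set z : R[i]^o | absc (phi x - z) < e]).
by apply/(rnbhsP (phi x : R[i]^o)); exists e.
Qed.

Lemma weak_cvg (F : set_system (weak V)) (x : weak V) : Filter F ->
  (forall (phi : dual V) (e : R), 0 < e -> F [set y | absc (phi x - phi y) < e]) ->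
  F --> x.
Proof.
move=> FF h A; rewrite nbhsE => -[B [[C Cop <-] /= Cx] BA].
pose j : weak V -> prod_topology (fun _ : dual V => R[i]^o) := fun x phi => phi x.
suff cj : j @ F --> j x.
  by apply: filterS BA _; apply: cj; exact: open_nbhs_nbhs.
(* The product topology is the supremum of those induced by the evaluations. [cvg_image] asks for
   the evaluation at [phi] to be onto, which the constant functions provide. *)
apply/cvg_sup => phi; apply/cvg_image.
  by apply/seteqP; split=> // z _; exists (fun=> z).
move=> U /(rnbhsP (phi x : R[i]^o)) [e e0 hU].
exists ((fun g : dual V -> R[i]^o => g phi) @^-1` U).
  by apply: filterS (h phi e e0) => y; exact: hU.
rewrite image_preimage//.
by apply/seteqP; split=> // z _; exists (fun=> z).
Qed.

(** A functional norming [x - y] separates the two points. This makes weakly compact sets weakly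
    closed, as [precompact] requires. *)
Lemma weak_hausdorff : hausdorff_space (weak V).
Proof.
move=> x y hxy; apply/eqP; rewrite -subr_eq0; apply/eqP/rnorm_eq0/le_anti.
rewrite rnorm_ge0 andbT.
have [phi [_ pxy]] := dual_norming (x - y : V).
rewrite -[rnorm _]ger0_norm ?rnorm_ge0// -absc_real -pxy dualB.
apply/ler_eps => e e0; rewrite add0r.
have e20 : 0 < e / 2 by rewrite divr_gt0.
have [z [/= /ltW h1 /ltW h2]] := hxy _ _ (weak_nbhs phi x e20) (weak_nbhs phi y e20).
have -> : phi x - phi y = (phi x - phi z) + - (phi y - phi z).
  by rewrite opprB addrA subrK.
apply: le_trans (abscD _ _) _; rewrite abscN.
by apply: le_trans (lerD h1 h2) _; rewrite -splitr.
Qed.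

End weak_topology.

(** * Weak compactness and the bidual *)

Section bidual.
Variables (R : realType) (V : normedModType R[i]).
Variables (Phi : {linear dual V -> R[i]^o}) (M : R).
Hypothesis PhiM : forall phi, absc (Phi phi) <= M * dual_norm phi.

(** Helly's theorem on the ball of radius [M]: if [psi], the combination of the functionals with
    coefficients c_i, is bounded by r on that ball, then M |psi| <= r, and hence |Phi psi| <= r. *)
Lemma goldstine (s : seq (dual V)) (d : R) : 0 <= M -> 0 < d ->
  exists2 x : V, rnorm x <= M & forall phi, phi \in s -> absc (phi x - Phi phi) <= d.
Proof.
move=> M0 d0.
pose f (i : 'I_(size s)) := dual_lin (tnth (in_tuple s) i).
pose b (i : 'I_(size s)) : R[i] := Phi (tnth (in_tuple s) i).
have [|||||x xM hx] := @helly _ V [set x | rnorm x <= M] _ _ _ _ f b _ _ d d0.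
- by exists 0; rewrite /= rnorm0.
- move=> t x y /andP[t0 t1] /= xM yM.
  have -> : x + t%:C *: (y - x) = (1 - t)%:C *: x + t%:C *: y.
    by rewrite rmorphB /= scalerBl scale1r scalerBr addrA addrAC.
  apply: le_trans (rnormD _ _) _.
  rewrite !rnormZ !absc_real !ger0_norm ?subr_ge0//.
  have -> : M = (1 - t) * M + t * M by ring.
  by apply: lerD; apply: ler_wpM2l => //; rewrite subr_ge0.
- by move=> c x c1 /= xM; rewrite rnormZ c1 mul1r.
- move=> i; exists (dual_norm (tnth (in_tuple s) i) * M) => x /= xM.
  by apply: le_trans (dual_normP _ _) _; rewrite ler_wpM2l ?dual_norm_ge0.
- move=> c r h; pose psi : dual V := \sum_i c i *: tnth (in_tuple s) i.
  have psiE x : psi x = \sum_i c i * f i x.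
    rewrite /psi; elim/big_rec2: _ => //= i y z _ <-.
    by [].
  have -> : \sum_i c i * b i = Phi psi.
    by rewrite linear_sum; apply: eq_bigr => i _; rewrite linearZ.
  apply: le_trans (PhiM _) _.
  have r0 : 0 <= r.
    by apply: le_trans (h 0 _); rewrite ?absc_ge0//= rnorm0.
  have [->|Mn0] := eqVneq M 0; first by rewrite mul0r.
  have {Mn0} Mp : 0 < M by rewrite lt_def Mn0.
  rewrite -ler_pdivlMl//; apply: dual_norm_le => [|x].
    by rewrite mulr_ge0// invr_ge0.
  have [->|x0] := eqVneq x 0; first by rewrite dual0 absc0 rnorm0 mulr0.
  have {}x0 : 0 < rnorm x.
    by rewrite lt_def rnorm_ge0 andbT; apply: contra_neq x0; exact: rnorm_eq0.
  have t0 : 0 < M / rnorm x by rewrite divr_gt0.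
  have -> : M^-1 * r * rnorm x = (M / rnorm x)^-1 * r by rewrite invf_div; ring.
  rewrite ler_pdivlMl//.
  have := h ((M / rnorm x)%:C *: x).
  rewrite -psiE dualZ abscM absc_real gtr0_norm//= rnormZ absc_real gtr0_norm//.
  by rewrite mulfVK ?gt_eqF// => /(_ (lexx _)).
- exists x => // phi /(@tnthP _ _ (in_tuple s)) [i ->].
  exact: hx.
Qed.

End bidual.

Section reflexive_weakly_compact.
Variables (R : realType) (V : normedModType R[i]).

(** Compactness of [-C, C] gives a cluster point; an ultrafilter omitting one of its neighbourhoods
    would contain the complement, so the cluster point is a limit. *)
Lemma ultra_real_limit (T : Type) (F : set_system T) (g : T -> R) (C : R) :
  UltraFilter F -> F [set x | `|g x| <= C] ->
  exists l : R, forall e, 0 < e -> F [set x | `|g x - l| < e].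
Proof.
move=> FU FC.
have gp : ProperFilter (g @ F) by apply: fmap_proper_filter.
have gC : (g @ F) [set` `[- C, C]].
  by apply: (@filterS _ F _ _ _ _ FC) => x /=; rewrite ler_norml in_itv.
have [l [_ gl]] := @segment_compact R (- C) C (g @ F) gp gC.
exists l => e e0.
have [//|nF] := in_ultra_setVsetC [set x | `|g x - l| < e] FU.
have le : nbhs l [set y | `|y - l| < e].
  by apply/nbhs_normP; exists e => //= y; rewrite /ball_ /= distrC.
have [|y [/= ny ye]] := gl (~` [set y | `|y - l| < e]) _ _ le.
  by apply: (@filterS _ F _ _ _ _ nF).
by [].
Qed.

(** The argument of Banach and Alaoglu in the bidual: the limits of [phi x] along an ultrafilter
    form a functional of norm at most 1 on the dual, which reflexivity turns into a point. The set
    is the closed unit ball, written through functionals so that its definition passes to the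
    limit. *)
Lemma reflexive_weak_compact : reflexive_space V ->
  compact [set x : weak V | forall phi : dual V, absc (phi x) <= dual_norm phi].
Proof.
move=> Vrefl; rewrite compact_ultra => F FU FK.
have limit phi : {l : R[i] | forall e, 0 < e -> F [set x | absc ((phi : dual V) x - l) < e]}.
  apply: cid.
  have Fbnd : F [set x | absc (phi x) <= dual_norm phi] by apply: filterS FK => x /=.
  have [|a ha] := @ultra_real_limit _ F (fun x => complex.Re (phi x)) (dual_norm phi) FU.
    apply: filterS Fbnd => x /=; apply: le_trans.
    rewrite -(@ler_pXn2r _ 2) ?nnegrE ?absc_ge0// absc_sqr real_normK ?num_real//.
    by rewrite lerDl sqr_ge0.
  have [|b hb] := @ultra_real_limit _ F (fun x => complex.Im (phi x)) (dual_norm phi) FU.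
    apply: filterS Fbnd => x /=; apply: le_trans.
    rewrite -(@ler_pXn2r _ 2) ?nnegrE ?absc_ge0// absc_sqr real_normK ?num_real//.
    by rewrite lerDr sqr_ge0.
  exists (a +i* b) => e e0; have e20 : 0 < e / 2 by rewrite divr_gt0.
  apply: filterS2 (ha _ e20) (hb _ e20) => x /= h1 h2.
  have -> : phi x - (a +i* b) = (complex.Re (phi x) - a)%:C + 'i * (complex.Im (phi x) - b)%:C.
    case: (phi x) => u v; apply/eqP; rewrite eq_complex /=.
    by apply/andP; split; apply/eqP; ring.
  apply: le_lt_trans (abscD _ _) _; rewrite abscM !absc_real.
  have -> : absc ('i : R[i]) = 1 by rewrite /absc normc_def /= expr0n expr1n add0r sqrtr1.
  by rewrite mul1r [e]splitr ltrD.
pose Psi phi : R[i]^o := sval (limit phi).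
have PsiP phi e : 0 < e -> F [set x | absc ((phi : dual V) x - Psi phi) < e].
  exact: (svalP (limit phi)).
have Psil : linear Psi.
  move=> c phi psi; apply/eqP; rewrite -subr_eq0 -absc_eq0; apply/eqP/le_anti.
  rewrite absc_ge0 andbT; apply/ler_eps => e e0; rewrite add0r.
  pose d := e / (2 + absc c).
  have c0 : 0 < 2 + absc c by rewrite ltr_pwDl// absc_ge0.
  have d0 : 0 < d by rewrite divr_gt0.
  have [x [[/= h1 h2] h3]] := filter_ex
    (filterI (filterI (PsiP phi _ d0) (PsiP psi _ d0)) (PsiP (c *: phi + psi) _ d0)).
  have {}h3 : absc (c * phi x + psi x - Psi (c *: phi + psi)) < d by exact: h3.
  have -> : Psi (c *: phi + psi) - (c *: Psi phi + Psi psi) =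
     - (c * phi x + psi x - Psi (c *: phi + psi)) + c * (phi x - Psi phi) + (psi x - Psi psi).
    by rewrite -[c *: Psi phi]/(c * Psi phi : R[i]); ring.
  apply: le_trans (abscD _ _) _; apply: le_trans (lerD (abscD _ _) (lexx _)) _.
  rewrite abscN abscM.
  have -> : e = d + absc c * d + d by rewrite /d; field; rewrite gt_eqF.
  apply: lerD; last exact: ltW.
  apply: lerD; first exact: ltW.
  by apply: ler_wpM2l; [exact: absc_ge0|exact: ltW].
pose PsiL : {linear dual V -> R[i]^o} :=
  HB.pack Psi (GRing.isLinear.Build R[i] (dual V) R[i]^o *:%R Psi Psil).
have [|x hx] := Vrefl PsiL.
  exists 1 => phi; rewrite mul1r; apply/ler_eps => e e0 /=.
  have [x [/= h1 h2]] := filter_ex (filterI FK (PsiP phi e e0)).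
  have -> : Psi phi = phi x + - (phi x - Psi phi) by rewrite opprB addrC subrK.
  apply: le_trans (abscD _ _) _; rewrite abscN.
  by apply: lerD; [exact: h1|exact: ltW].
exists x; split=> /=.
  move=> phi; rewrite -hx; apply/ler_eps => e e0 /=.
  have [y [/= h1 h2]] := filter_ex (filterI FK (PsiP phi e e0)).
  have -> : Psi phi = phi y + - (phi y - Psi phi) by rewrite opprB addrC subrK.
  apply: le_trans (abscD _ _) _; rewrite abscN.
  by apply: lerD; [exact: h1|exact: ltW].
apply: weak_cvg => phi e e0; apply: filterS (PsiP phi e e0) => y /=.
by rewrite -hx abscB.
Qed.

End reflexive_weakly_compact.

Section weakly_compact.
Variables (R : realType) (E F : normedModType R[i]).

(** The easy implication: a bounded linear map is continuous between weak topologies, so it carries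
    the weakly compact unit ball of [G] to a weakly compact set. *)
Lemma factor_weakly_compact (G : normedModType R[i]) (iota : {linear G -> F})
    (S : {linear E -> G}) (C D : R) : reflexive_space G ->
  (forall x, rnorm (iota x) <= C * rnorm x) ->
  (forall x, rnorm (S x) <= D * rnorm x) ->
  weakly_compact (fun x => iota (S x)).
Proof.
move=> Grefl iotaC SD.
have [D1 D10 {}SD] : exists2 D1, 0 < D1 & forall x, rnorm (S x) <= D1 * rnorm x.
  exists (1 + `|D|) => [|x]; first by rewrite ltr_pwDl.
  apply: le_trans (SD x) _; rewrite ler_wpM2r ?rnorm_ge0//.
  by rewrite (le_trans (ler_norm D))// lerDr.
pose K := [set x : weak G | forall phi : dual G, absc (phi x) <= dual_norm phi].
(* The factor [D1] is moved from [S] into this map, so that the unit ball [K] itself suffices. *)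
pose h (x : weak G) : weak F := D1%:C *: iota x.
have hc : continuous h.
  move=> x; have fx : Filter (h @ x) by exact: (fmap_filter h (nbhs_filter x)).
  apply: weak_cvg => phi e e0.
  have [C' hC'] := dual_bounded phi.
  have [|psi psiE] := @dual_of_linear _ G (dual_lin phi \o iota) (`|C'| * C).
    move=> y /=; apply: le_trans (hC' _) _; rewrite -mulrA.
    apply: le_trans (ler_wpM2r (rnorm_ge0 _) (ler_norm C')) _.
    exact: ler_wpM2l.
  have e1 : 0 < e / D1 by rewrite divr_gt0.
  apply: filterS (weak_nbhs psi x e1) => y /=.
  rewrite !psiE /= /h !dualZ -mulrBr abscM absc_real gtr0_norm//.
  by rewrite ltr_pdivlMr// mulrC.
have hK : compact (h @` K).
  apply: continuous_compact; last exact: reflexive_weak_compact.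
  exact: continuous_subspaceT.
exists (h @` K); last by split=> //; apply: compact_closed => //; exact: weak_hausdorff.
move=> _ [x /= x1 <-]; exists (D1^-1%:C *: S x).
  move=> phi; apply: le_trans (dual_normP _ _) _; rewrite ler_piMr ?dual_norm_ge0//.
  rewrite rnormZ absc_real gtr0_norm ?invr_gt0// ler_pdivrMl// mulr1.
  by apply: le_trans (SD x) _; rewrite ler_piMr ?(ltW D10)// rnorm_le.
rewrite /h linearZ /= scalerA -rmorphM /= mulfV ?gt_eqF// scale1r//.
Qed.

(** The approximants for finite sets of functionals, rescaled by 1/C into the compact set [K], form
    a filter base; [C] times a weak cluster point satisfies all the inequalities at once. *)
Lemma weakly_compact_approx (T : {linear E -> F}) (Psi : dual F -> R[i])
    (eps : dual F -> R) (C : R) : 0 <= C -> weakly_compact T ->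
  (forall (s : seq (dual F)) (d : R), 0 < d -> exists2 u, rnorm u <= C &
     forall phi, phi \in s -> absc (phi (T u) - Psi phi) <= eps phi + d) ->
  exists w : F, forall phi : dual F, absc (phi w - Psi phi) <= eps phi.
Proof.
move=> C0 [K TK [Kc _]] H.
pose B (i : seq (dual F) * R) := [set w : weak F | K w /\
  forall phi, phi \in i.1 -> absc (C%:C * phi w - Psi phi) <= eps phi + i.2].
pose D := [set i : seq (dual F) * R | 0 < i.2].
pose FF := filter_from D B.
have FFp : ProperFilter FF.
  apply: filter_from_proper; last first.
    move=> [s d] /= d0; have [u uC hu] := H s d d0.
    (* Rescaling is impossible for C = 0, but then [u] is 0. *)
    have [Cz|Cz] := eqVneq C 0.
      exists (T 0); split; first by apply: TK; exists 0; rewrite //= normr0.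
      have u0 : u = 0 by apply/rnorm_eq0/le_anti; rewrite rnorm_ge0 -Cz uC.
      by move=> phi /hu; rewrite u0 linear0 dual0 Cz mul0r.
    have Cp : 0 < C by rewrite lt_def Cz.
    exists (T (C^-1%:C *: u)); split.
      apply: TK; exists (C^-1%:C *: u) => //=.
      by rewrite -rnorm_le rnormZ absc_real gtr0_norm ?invr_gt0// ler_pdivrMl// mulr1.
    move=> phi /hu; rewrite linearZ dualZ mulrA -rmorphM /= mulfV//.
    by rewrite mul1r.
  apply: filter_from_filter; first by exists ([::], 1) => /=; rewrite /D /=.
  move=> [s d] [s' d'] /= d0 d'0; exists (s ++ s', Num.min d d').
    by rewrite /D /= lt_min d0.
  move=> w [Kw hw]; split; split=> // phi ph.
    apply: le_trans (hw phi _) _; first by rewrite mem_cat ph.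
    by rewrite lerD2l ge_min lexx.
  apply: le_trans (hw phi _) _; first by rewrite mem_cat ph orbT.
  by rewrite lerD2l ge_min lexx orbT.
have [w [Kw clw]] : K `&` cluster FF !=set0.
  by apply: Kc; exists ([::], 1); rewrite /D //= => w [].
exists (C%:C *: (w : F)) => phi; rewrite dualZ; apply/ler_eps => e e0.
pose d := e / (1 + C).
have C1 : 0 < 1 + C by rewrite ltr_pwDl.
have d0 : 0 < d by rewrite divr_gt0.
have [|y [[Ky hy] /= /ltW hwy]] := clw (B ([:: phi], d)) _ _ (weak_nbhs phi w d0).
  by exists ([:: phi], d).
have {}hy := hy phi (mem_head _ _).
have -> : C%:C * phi w - Psi phi = C%:C * (phi w - phi y) + (C%:C * phi y - Psi phi).
  by ring.
apply: le_trans (abscD _ _) _; rewrite abscM absc_real ger0_norm//.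
have -> : eps phi + e = C * d + (eps phi + d) by rewrite /d; field; rewrite gt_eqF.
by apply: lerD; [exact: ler_wpM2l|].
Qed.

End weakly_compact.

(** * Reflexivity of l2-interpolation spaces *)

Section sandwich.
Variables (R : realType) (V W : lmodType R[i]) (iota : {linear W -> V}).

(** Hahn-Banach for the infimal convolution, the infimum over w of r w + p (y + iota w): it is at
    most [p y] (take w = 0) and at most [r w] at the point - iota w. The hypothesis keeps it above -
    p (- y). *)
Lemma hahn_banach_sandwich (p : V -> R) (r : W -> R) :
  sublinear p -> sublinear r -> (forall w, 0 <= r w + p (iota w)) ->
  exists g : {linear V -> R[i]^o}, (forall x, complex.Re (g x) <= p x) /\
    forall w, - r w <= complex.Re (g (iota w)).
Proof.
move=> hp hr rp.
pose S y := [set r w + p (y + iota w) | w in [set: W]].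
have lb y : has_lbound (S y).
  exists (- p (- y)) => _ [w _ <-].
  have := hp.1 (- y) (y + iota w); rewrite addKr => h.
  by have := rp w; lra.
have q_le y w : inf (S y) <= r w + p (y + iota w) by apply: ge_inf => //; exists w.
have le_q y c : (forall w, c <= r w + p (y + iota w)) -> c <= inf (S y).
  move=> h; apply: lb_le_inf; first by exists (r 0 + p (y + iota 0)), 0.
  by move=> _ [w _ <-]; exact: h.
have hq : sublinear (fun y => inf (S y)).
  split=> [x y|t x].
    rewrite -lerBlDr; apply: (le_q) => v.
    rewrite lerBlDr -lerBlDl; apply: (le_q) => w; rewrite lerBlDl.
    apply: le_trans (q_le _ (v + w)) _.
    rewrite linearD /= [leRHS]addrACA (addrACA x y); apply: lerD; [exact: hr.1|exact: hp.1].
  rewrite le_eqVlt => /predU1P[<-|t0].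
    rewrite scale0r mul0r; apply/le_anti/andP; split.
      apply: le_trans (q_le _ 0) _.
      by rewrite linear0 addr0 (sublinear0 hp) (sublinear0 hr) addr0.
    by apply: (le_q) => w; rewrite add0r.
  apply/le_anti/andP; split.
    rewrite -ler_pdivrMl//; apply: (le_q) => w; rewrite ler_pdivrMl//.
    apply: le_trans (q_le _ (t%:C *: w)) _.
    by rewrite linearZ -scalerDr (hr.2 _ _ (ltW t0)) (hp.2 _ _ (ltW t0)) mulrDr.
  apply: (le_q) => w.
  have -> : w = t%:C *: (t^-1%:C *: w).
    by rewrite scalerA -rmorphM /= mulfV ?gt_eqF// scale1r.
  move: (t^-1%:C *: w) => v; rewrite linearZ -scalerDr (hr.2 _ _ (ltW t0)) (hp.2 _ _ (ltW t0)) -mulrDr ler_pM2l//.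
have [g [gq _]] := hahn_banach_complex 0 hq.
exists g; split=> [x|w].
  apply: le_trans (gq x) _; apply: le_trans (q_le _ 0) _.
  by rewrite linear0 addr0 (sublinear0 hr) add0r.
rewrite lerNl.
have -> : - complex.Re (g (iota w)) = complex.Re (g (- iota w)).
  by rewrite linearN raddfN.
apply: le_trans (gq _) _; apply: le_trans (q_le _ w) _.
by rewrite addNr (sublinear0 hp) addr0.
Qed.

End sandwich.

Section complete.
Variables (R : realType) (V : completeNormedModType R[i]).

Lemma rcauchy_cvg (F : set_system V) : ProperFilter F ->
  (forall e : R, 0 < e -> exists x, F [set y | rnorm (x - y) < e]) ->
  exists l, forall e : R, 0 < e -> F [set y | rnorm (l - y) < e].
Proof.
move=> FF h.
have Fl : F --> lim F.
  apply/cauchy_cvgP/cauchy_exP => e e0.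
  have eE : e = (complex.Re e)%:C by rewrite RRe_real// gtr0_real.
  have [|x hx] := h (complex.Re e); first by rewrite -ltcR -eE.
  exists x; apply: filterS hx => y /=.
  by rewrite -ball_normE /= -ltcR -eE rnormC.
exists (lim F) => e e0; apply: Fl.
by apply/rnbhsP; exists e.
Qed.

End complete.

Section l2_interpolation.
Variables (R : realType) (E G : normedModType R[i]) (F : completeNormedModType R[i]).
Variables (T : {linear E -> F}) (iota : {linear G -> F}) (K : nat -> F -> R).

(** The l^2 norm enters only as the supremum of these partial sums, through [GP]. Reflexivity uses
    level 1 alone and any seminorms [K]; [approx] is the only link between [G] and [T]. *)
Definition l2_partial (N : nat) (y : F) : R :=
  l2 (index_iota 0 N) xpredT (fun n => K n y).
Let P := l2_partial.

Hypotheses (Ksemi : forall n, seminorm (K n))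
  (PF : forall N, exists C, forall y, P N y <= C * rnorm y)
  (GP : forall g r, rnorm g <= r <-> forall N, P N (iota g) <= r)
  (G_onto : forall y r, (forall N, P N y <= r) -> exists g, iota g = y)
  (iota_le : forall g, rnorm (iota g) <= rnorm g)
  (approx : forall M e : R, 0 <= M -> 0 < e -> exists2 C, 0 <= C &
     forall g, rnorm g <= M -> exists2 u, rnorm u <= C & rnorm (iota g - T u) <= e)
  (Twc : weakly_compact T).

Lemma l2_seminorm (s : seq nat) : seminorm (fun y => l2 s xpredT (fun n => K n y)).
Proof.
have K0 n y : 0 <= K n y.
  have [KD KZ] := Ksemi n; have := KD y (- y); rewrite subrr -scaleN1r KZ abscN absc1 mul1r.
  have -> : K n 0 = 0 by have := KZ 0 0; rewrite scaler0 absc0 mul0r.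
  by rewrite -mulr2n pmulrn_lge0.
split=> [x y|c x].
  by apply: le_trans (l2D _ _ _ _); apply: le_l2 => n _; rewrite K0 (Ksemi n).1.
rewrite -l2Z ?absc_ge0//; congr Num.sqrt; apply: eq_bigr => n _.
by rewrite (Ksemi n).2.
Qed.

Lemma l2_partial_seminorm N : seminorm (P N).
Proof. exact: l2_seminorm. Qed.

Lemma l2_partial_le g N : P N (iota g) <= rnorm g.
Proof. by have /GP := lexx (rnorm g). Qed.

Let tail N N' y := l2 (index_iota N N') xpredT (fun n => K n y).

Lemma l2_partial_split N N' y : (N <= N')%N ->
  P N' y ^+ 2 = P N y ^+ 2 + tail N N' y ^+ 2.
Proof. by move=> NN'; rewrite !l2_sqr -big_cat_nat. Qed.

(** Otherwise all P N (iota g)^2 are at most |g|^2 - d^2, and [GP] makes the norm of [g] smaller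
    than itself. *)
Lemma l2_tail_small g (d : R) : 0 < d -> exists N, forall N', (N <= N')%N ->
  tail N N' (iota g) <= d.
Proof.
move=> d0; apply: contrapT => /forallNP h.
have Plt N : P N (iota g) ^+ 2 <= rnorm g ^+ 2 - d ^+ 2.
  have /existsNP[N' /not_implyP[NN' /negP]] := h N.
  rewrite -ltNge lerBrDr => dt.
  have : P N' (iota g) ^+ 2 <= rnorm g ^+ 2.
    by rewrite ler_pXn2r ?nnegrE ?l2_ge0 ?rnorm_ge0// l2_partial_le.
  rewrite (l2_partial_split _ NN'); apply: le_trans.
  by rewrite lerD2l ler_pXn2r ?nnegrE ?l2_ge0 ?(ltW d0)// ltW.
have c0 : 0 <= rnorm g ^+ 2 - d ^+ 2 by apply: le_trans (Plt 0); exact: sqr_ge0.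
have /GP : forall N, P N (iota g) <= Num.sqrt (rnorm g ^+ 2 - d ^+ 2).
  move=> N; rewrite -(@ler_pXn2r _ 2) ?nnegrE ?l2_ge0 ?sqrtr_ge0//.
  by rewrite (sqr_sqrtr c0); exact: Plt.
rewrite -(@ler_pXn2r _ 2) ?nnegrE ?rnorm_ge0 ?sqrtr_ge0// sqr_sqrtr//.
by rewrite lerBrDr gerDl leNgt exprn_gt0.
Qed.

(* An almost norming vector [y] of [phi] lives essentially on finitely many
   coordinates; perturbing it by [t *: x], with [x] small there, increases
   the norm by [O(t ^ 2)] but [phi] by [t * phi x]. *)
Lemma dual_small (phi : dual G) (e : R) : 0 < e -> exists N, exists2 d, 0 < d &
  forall x, rnorm x <= 1 -> P N (iota x) <= d -> absc (phi x) <= e.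
Proof.
move=> e0; set L := dual_norm phi; have L0 : 0 <= L by exact: dual_norm_ge0.
have L1 : 0 < 1 + L by rewrite ltr_pwDl.
(* These constants give L t <= e and 8 L d <= e. The norming defect t e / 4 and the growth L (t^2 /
   2 + 2 t d) of the bound then add up to at most t e, whence |phi x| <= e. *)
pose t := e / (1 + L); pose d := e / (8 * (1 + L)).
have t0 : 0 < t by rewrite divr_gt0.
have d0 : 0 < d by rewrite divr_gt0// mulr_gt0.
have [||_ [y /= y1 <-] yL] := @sup_adherent _
    [set absc (phi x) | x in [set x : G | `|x| <= 1]] (t * e / 4).
- by rewrite divr_gt0// mulr_gt0.
- split; last exact: dual_norm_ubound.
  by exists (absc (phi 0)), 0; rewrite //= normr0.
rewrite -/(dual_norm phi) -/L -rnorm_le in yL y1.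
have [N hN] := l2_tail_small y d0.
exists N, d => // x x1 xd.
have [a a1 ya] := absc_rotate (phi y); have [b b1 xb] := absc_rotate (phi x).
pose y' := a *: y; pose x' := b *: x.
(* [rho] is an upper bound for the square root of 1 + t^2 + 4 t d. The two cross terms are at most d
   each: [x] is small on the first N coordinates, [y] on the later ones. *)
pose rho := 1 + t ^+ 2 / 2 + 2 * t * d.
have rho0 : 0 <= rho by have := sqr_ge0 t; have := mulr_gt0 t0 d0; rewrite /rho; lra.
have zrho : rnorm (y' + t%:C *: x') <= rho.
  apply/GP => N'.
  (* Partial sums increase, so N' may be taken at least N, where they split into head and tail. *)
  have [N1 NN' /le_trans] : exists2 N1, (N <= N1)%N &
      P N' (iota (y' + t%:C *: x')) <= P N1 (iota (y' + t%:C *: x')).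
    exists (maxn N N'); first exact: leq_maxl.
    rewrite -(@ler_pXn2r _ 2) ?nnegrE ?l2_ge0//.
    by rewrite (l2_partial_split _ (leq_maxr N N')) lerDl sqr_ge0.
  apply; rewrite -(@ler_pXn2r _ 2) ?nnegrE ?l2_ge0//.
  move: N1 NN' => {}N' NN'; rewrite (l2_partial_split _ NN').
  have bnd q : seminorm q -> q (iota (y' + t%:C *: x')) <= q (iota y) + t * q (iota x).
    move=> [qD qZ].
    have -> : iota (y' + t%:C *: x') = a *: iota y + (t%:C * b) *: iota x.
      by rewrite /y' /x' scalerA linearD !linearZ.
    apply: le_trans (qD _ _) _.
    by rewrite !qZ abscM absc_real gtr0_norm// a1 b1 mul1r mulr1.
  have bP := bnd _ (l2_partial_seminorm N).
  have bt := bnd _ (l2_seminorm (index_iota N N')).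
  have yN := l2_partial_split (iota y) NN'; have xN := l2_partial_split (iota x) NN'.
  have yN1 : P N' (iota y) ^+ 2 <= 1.
    by rewrite exprn_ile1 ?l2_ge0// (le_trans (l2_partial_le _ _)).
  have xN1 : P N' (iota x) ^+ 2 <= 1.
    by rewrite exprn_ile1 ?l2_ge0// (le_trans (l2_partial_le _ _)).
  have ty := hN _ NN'.
  have Py1 : P N (iota y) <= 1 by apply: le_trans (l2_partial_le _ _) _.
  rewrite {}yN in yN1; rewrite {}xN in xN1.
  have := l2_ge0 (index_iota 0 N) xpredT (fun n => K n (iota y)).
  have := l2_ge0 (index_iota 0 N) xpredT (fun n => K n (iota x)).
  have := l2_ge0 (index_iota N N') xpredT (fun n => K n (iota y)).
  have := l2_ge0 (index_iota N N') xpredT (fun n => K n (iota x)).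
  have := l2_ge0 (index_iota 0 N) xpredT (fun n => K n (iota (y' + t%:C *: x'))).
  have := l2_ge0 (index_iota N N') xpredT (fun n => K n (iota (y' + t%:C *: x'))).
  rewrite -!/(l2_partial _ _) -!/(tail _ _ _) -!/P in bP bt *.
  move: bP bt xN1 yN1 xd ty Py1.
  move: (P N (iota y)) (P N (iota x)) (tail N N' (iota y)) (tail N N' (iota x)).
  move: (P N _) (tail N N' _) => Z1 Z2 Y1 X1 Y2 X2 bP bt xN1 yN1 xd ty Py1 Z20 Z10 X20 Y20 X10 Y10.
  have X21 : X2 <= 1 by nra.
  have tX1 : 0 <= Y1 + t * X1 by rewrite addr_ge0// mulr_ge0// ltW.
  have tX2 : 0 <= Y2 + t * X2 by rewrite addr_ge0// mulr_ge0// ltW.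
  have s1 : Z1 ^+ 2 <= (Y1 + t * X1) ^+ 2 by rewrite ler_pXn2r// nnegrE.
  have s2 : Z2 ^+ 2 <= (Y2 + t * X2) ^+ 2 by rewrite ler_pXn2r// nnegrE.
  have c1 : Y1 * X1 <= d by nra.
  have c2 : Y2 * X2 <= d by nra.
  have c3 : t * (Y1 * X1) <= t * d by rewrite ler_pM2l.
  have c4 : t * (Y2 * X2) <= t * d by rewrite ler_pM2l.
  have c5 : t ^+ 2 * (X1 ^+ 2 + X2 ^+ 2) <= t ^+ 2 * 1 by rewrite ler_pM2l// exprn_gt0.
  have c6 : 1 + t ^+ 2 + 4 * t * d <= rho ^+ 2.
    have r0 : 0 <= t ^+ 2 / 2 + 2 * t * d.
      by have := sqr_ge0 t; have := mulr_gt0 t0 d0; lra.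
    have -> : rho = 1 + (t ^+ 2 / 2 + 2 * t * d) by rewrite /rho addrA.
    move: (sqr_ge0 (t ^+ 2 / 2 + 2 * t * d)) => q0.
    have -> : (1 + (t ^+ 2 / 2 + 2 * t * d)) ^+ 2 =
      1 + t ^+ 2 + 4 * t * d + (t ^+ 2 / 2 + 2 * t * d) ^+ 2 by field.
    by rewrite lerDl.
  by lra.
have : complex.Re (phi (y' + t%:C *: x')) <= L * rho.
  apply: le_trans (Re_le_absc _) _; apply: le_trans (dual_normP _ _) _.
  exact: ler_wpM2l.
have -> : complex.Re (phi (y' + t%:C *: x')) = absc (phi y) + t * absc (phi x).
  rewrite dualD dualZ /y' /x' !dualZ -ya -xb.
  by case: (a * phi y) => ? ?; case: (b * phi x) => ? ? /=; ring.
move=> h.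
have Lt : L * t <= e.
  by rewrite /t mulrCA ler_piMr ?(ltW e0)// ler_pdivrMr// mul1r lerDr.
have Ld : 8 * (L * d) <= e.
  have -> : 8 * (L * d) = L * t by rewrite /d /t; field; rewrite gt_eqF.
  exact: Lt.
rewrite -(ler_pM2l t0).
have h1 : t * (L * t) <= t * e by rewrite ler_pM2l.
have h2 : t * (8 * (L * d)) <= t * e by rewrite ler_pM2l.
move: h yL; rewrite /rho; set X := absc (phi x); set Y := absc (phi y) => h yL.
have h3 : L * (1 + t ^+ 2 / 2 + 2 * t * d) = L + (t * (L * t)) / 2 + 2 * (t * (L * d)) by field.
by rewrite h3 in h; lra.
Qed.

(** Homogeneous form of [dual_small]: division by [s] meets both of its conditions. *)
Lemma dual_l2_le (phi : dual G) (e : R) : 0 < e -> exists N, exists2 C, 0 <= C &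
  forall x, absc (phi x) <= e * rnorm x + C * P N (iota x).
Proof.
move=> e0; have [N [d d0 h]] := dual_small phi e0; exists N, (e / d).
  by rewrite divr_ge0 ?ltW.
move=> x; pose s := rnorm x + P N (iota x) / d.
have [->|x0] := eqVneq x 0.
  rewrite dual0 absc0 rnorm0 mulr0 add0r mulr_ge0 ?l2_ge0//.
  by rewrite divr_ge0 ?ltW.
have {}x0 : 0 < rnorm x.
  by rewrite lt_def rnorm_ge0 andbT; apply: contra_neq x0; exact: rnorm_eq0.
have s0 : 0 < s by rewrite ltr_wpDr// divr_ge0 ?l2_ge0 ?ltW.
have -> : e * rnorm x + e / d * P N (iota x) = e * s by rewrite /s; field; rewrite gt_eqF.
rewrite mulrC -ler_pdivrMl//.
have := h (s^-1%:C *: x); rewrite dualZ abscM absc_real gtr0_norm ?invr_gt0//; apply.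
  rewrite rnormZ absc_real gtr0_norm ?invr_gt0// ler_pdivrMl// mulr1 lerDl.
  by rewrite divr_ge0 ?l2_ge0 ?ltW.
rewrite linearZ (l2_partial_seminorm N).2 absc_real gtr0_norm ?invr_gt0//.
rewrite ler_pdivrMl// /s mulrDl mulfVK ?gt_eqF// lerDr mulr_ge0 ?ltW//.
Qed.

(** By [dual_l2_le] the real part of [phi] is at most e |x| + C P N (iota x). The sandwich theorem
    splits off a functional dominated by C P N, which is continuous on [F] by [PF]. *)
Lemma dual_dense (phi : dual G) (e : R) : 0 < e -> exists f : dual F,
  forall x, absc (phi x - f (iota x)) <= e * rnorm x.
Proof.
move=> e0; have [N [C C0 h]] := dual_l2_le phi e0.
have [PD PZ] := l2_partial_seminorm N.
have [|||g [gP gphi]] := @hahn_banach_sandwich _ _ _ iota (fun y => C * P N y)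
    (fun x => e * rnorm x - complex.Re (phi x)).
- split=> [x y|t x t0]; first by rewrite -mulrDr ler_wpM2l.
  by rewrite PZ absc_real ger0_norm// mulrCA.
- split=> [x y|t x t0].
    rewrite dualD raddfD /= opprD addrACA lerD2r -mulrDr ler_wpM2l ?rnormD//.
    exact: ltW.
  rewrite rnormZ dualZ absc_real ger0_norm// mulrBr mulrCA; congr (_ - _).
  by case: (phi x) => a b /=; ring.
- move=> x; rewrite addrAC subr_ge0; apply: le_trans (Re_le_absc _) _.
  exact: h.
have [C' hC'] := PF N.
have gC : forall x, absc (g x) <= C * C' * rnorm x.
  move=> x; apply: (@le_trans _ _ (C * P N x)); last by rewrite -mulrA ler_wpM2l.
  by apply: (@linear_absc_le _ _ g (fun y => C * P N y)) => // y c c1; rewrite PZ c1 mul1r.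
have [f fE] := dual_of_linear gC.
exists f => x; rewrite fE; have [u u1 <-] := absc_rotate (phi x - g (iota x)).
have := gphi (u *: x).
rewrite rnormZ u1 mul1r linearZ linearZ dualZ /= -[u *: g _]/(u * g _ : R[i]) mulrBr raddfB /=.
by move=> h1; lra.
Qed.

Variables (Phi : {linear dual G -> R[i]^o}) (M : R).
Hypotheses (M0 : 0 <= M) (PhiM : forall phi, absc (Phi phi) <= M * dual_norm phi).

Let pull_ex (f : dual F) : exists psi : dual G, forall x, psi x = f (iota x).
Proof.
have [C hC] := dual_bounded f.
apply: (@dual_of_linear _ G (dual_lin f \o iota) `|C|) => x /=.
apply: le_trans (hC _) _; apply: le_trans (ler_wpM2r (rnorm_ge0 _) (ler_norm C)) _.
exact: ler_wpM2l.
Qed.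

(** The adjoint of [iota], from the dual of [F] to the dual of [G]. *)
Let pull f := sval (cid (pull_ex f)).
Let pullE f x : pull f x = f (iota x). Proof. exact: (svalP (cid (pull_ex f))). Qed.

(** Goldstine's theorem approximates [Phi] by points of [G], and [approx] replaces these by points
    [T u] at the uniform cost e |f|, so that weak compactness of [T] applies. *)
Lemma bidual_approx (e : R) : 0 < e ->
  exists w : F, forall f : dual F, absc (f w - Phi (pull f)) <= e * dual_norm f.
Proof.
move=> e0; have [C C0 hC] := approx M0 e0.
apply: (weakly_compact_approx (C := C) C0 Twc) => s d d0.
have [x xM hx] := goldstine PhiM (map pull s) M0 d0.
have [u uC hu] := hC _ xM; exists u => // f fs.
have /hx := map_f pull fs; rewrite pullE => h.
have -> : f (T u) - Phi (pull f) = - f (iota x - T u) + (f (iota x) - Phi (pull f)).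
  by rewrite dualB; ring.
apply: le_trans (abscD _ _) _; apply: lerD => //; rewrite abscN.
apply: le_trans (dual_normP _ _) _.
by rewrite mulrC ler_wpM2r// dual_norm_ge0.
Qed.

(** Two approximate representatives for the tolerances e and e' differ by at most (e + e') |f| on
    each f. They are therefore Cauchy in norm, and [F] is complete. *)
Lemma bidual_eval : exists w : F, forall f : dual F, Phi (pull f) = f w.
Proof.
pose B e := [set w : F | forall f : dual F, absc (f w - Phi (pull f)) <= e * dual_norm f].
pose D := [set e : R | 0 < e].
have BF : ProperFilter (filter_from D B).
  apply: filter_from_proper; last by move=> e /bidual_approx.
  apply: filter_from_filter; first by exists 1; rewrite /D /=.
  move=> e e' e0 e'0; exists (Num.min e e'); first by rewrite /D /= lt_min e0.
  move=> w hw; split=> f; apply: le_trans (hw f) _; rewrite ler_wpM2r ?dual_norm_ge0//.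
    by rewrite ge_min lexx.
  by rewrite ge_min lexx orbT.
have [e e0|w hw] := rcauchy_cvg BF.
  have e4 : 0 < e / 4 by rewrite divr_gt0.
  have [w hw] := bidual_approx e4; exists w; exists (e / 4) => // v hv /=.
  apply: (@le_lt_trans _ _ (e / 2)); last by lra.
  apply: rnorm_le_dual; last by rewrite divr_ge0// ltW.
  move=> f; rewrite dualB.
  have -> : f w - f v = (f w - Phi (pull f)) + - (f v - Phi (pull f)) by ring.
  apply: le_trans (abscD _ _) _; rewrite abscN.
  by apply: le_trans (lerD (hw f) (hv f)) _; rewrite -mulrDl ler_wpM2r ?dual_norm_ge0//; lra.
exists w => f; apply/eqP; rewrite eq_sym -subr_eq0 -absc_eq0; apply/eqP/le_anti.
rewrite absc_ge0 andbT; apply/ler_eps => e e0; rewrite add0r.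
pose d := e / (2 * (1 + dual_norm f)).
have f1 : 0 < 1 + dual_norm f by rewrite ltr_pwDl// dual_norm_ge0.
have d0 : 0 < d by rewrite divr_gt0// mulr_gt0.
have Bd : filter_from D B (B d) by exists d.
have [v [/= h1 h2]] := filter_ex (filterI (hw d d0) Bd).
have -> : f w - Phi (pull f) = f (w - v) + (f v - Phi (pull f)) by rewrite dualB; ring.
apply: le_trans (abscD _ _) _.
apply: (@le_trans _ _ (dual_norm f * d + d * dual_norm f)).
  apply: lerD => //; apply: le_trans (dual_normP _ _) _.
  by rewrite ler_wpM2l ?dual_norm_ge0// ltW.
have -> : e = d + d * dual_norm f + (d + d * dual_norm f).
  by rewrite /d; field; rewrite gt_eqF.
by rewrite mulrC lerD// lerDr ltW.
Qed.

Lemma bidual_represented : exists x : G, forall phi, Phi phi = phi x.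
Proof.
have [w hw] := bidual_eval.
(* A functional norming [w] for [P N] pulls back to one of norm at most 1 on [G], so P N w <= M for
   every N; this puts [w] into [G]. *)
have [N|g gw] := @G_onto w M.
  have [h [hP hw']] := hahn_banach_norming w (l2_partial_seminorm N).
  have [C hC] := PF N.
  have [f fE] := @dual_of_linear _ _ h C (fun x => le_trans (hP x) (hC x)).
  have <- : absc (f w) = P N w by rewrite fE hw' absc_real ger0_norm ?l2_ge0.
  rewrite -hw; apply: le_trans (PhiM _) _; rewrite ler_piMr// dual_norm_le// => x.
  by rewrite pullE fE mul1r; apply: le_trans (hP _) _; exact: l2_partial_le.
exists g => phi; apply/eqP; rewrite -subr_eq0 -absc_eq0; apply/eqP/le_anti.
rewrite absc_ge0 andbT; apply/ler_eps => e e0; rewrite add0r.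
pose d := e / (1 + (M + rnorm g)).
have D0 : 0 < 1 + (M + rnorm g) by rewrite ltr_pwDl// addr_ge0// rnorm_ge0.
have d0 : 0 < d by rewrite divr_gt0.
(* [Phi] and evaluation at [g] agree on pulled-back functionals, and these are dense. *)
have [f hf] := dual_dense phi d0.
have subE x : (phi - pull f : dual G) x = phi x - pull f x by [].
have -> : Phi phi - phi g = Phi (phi - pull f) - (phi - pull f : dual G) g.
  by rewrite subE linearB hw -gw -pullE; ring.
have hd x : absc ((phi - pull f : dual G) x) <= d * rnorm x.
  by rewrite subE pullE.
apply: le_trans (abscD _ _) _; rewrite abscN.
apply: (@le_trans _ _ (M * d + d * rnorm g)).
  apply: lerD => //; apply: le_trans (PhiM _) _.
  by rewrite ler_wpM2l// dual_norm_le// ltW.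
have -> : e = d + (M * d + d * rnorm g) by rewrite /d; field; rewrite gt_eqF.
by rewrite lerDr ltW.
Qed.

End l2_interpolation.

(** * Matrix seminorms and operator space structures *)

Section sandwich_algebra.
Variables (C : comNzRingType) (V W : lmodType C).

Lemma mxsandwichM m n p q m' q' (a' : 'M[C]_(m', m)) (a : 'M[C]_(m, n))
    (x : 'M[V]_(n, p)) (b : 'M[C]_(p, q)) (b' : 'M[C]_(q, q')) :
  mxsandwich a' (mxsandwich a x b) b' = mxsandwich (a' *m a) x (b *m b').
Proof.
apply/matrixP => i j; rewrite !mxE.
transitivity (\sum_k \sum_l \sum_s \sum_t (a' i k * b' l j) *: ((a k s * b t l) *: x s t)).
  apply: eq_bigr => k _; apply: eq_bigr => l _; rewrite mxE scaler_sumr.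
  by apply: eq_bigr => s _; rewrite scaler_sumr.
transitivity (\sum_s \sum_t \sum_k \sum_l ((a' i k * a k s) * (b t l * b' l j)) *: x s t).
  under eq_bigr do rewrite exchange_big /=.
  rewrite exchange_big /=; apply: eq_bigr => s _.
  under eq_bigr do rewrite exchange_big /=.
  rewrite exchange_big /=; apply: eq_bigr => t _.
  apply: eq_bigr => k _; apply: eq_bigr => l _.
  by rewrite scalerA; congr (_ *: _); ring.
apply: eq_bigr => s _; apply: eq_bigr => t _.
rewrite !mxE mulr_suml scaler_suml; apply: eq_bigr => k _.
by rewrite mulr_sumr scaler_suml.
Qed.

Lemma mxsandwichD m n p q (a : 'M[C]_(m, n)) (x y : 'M[V]_(n, p)) (b : 'M[C]_(p, q)) :
  mxsandwich a (x + y) b = mxsandwich a x b + mxsandwich a y b.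
Proof.
apply/matrixP => i j; rewrite !mxE -big_split /=; apply: eq_bigr => k _.
by rewrite -big_split /=; apply: eq_bigr => l _; rewrite mxE scalerDr.
Qed.

Lemma mxsandwich_scalar m p (c d : C) (x : 'M[V]_(m, p)) :
  mxsandwich c%:M x d%:M = map_mx ( *:%R (c * d)) x.
Proof.
apply/matrixP => i j; rewrite !mxE (bigD1 i)//= (bigD1 j)//= !mxE !eqxx !mulr1n.
rewrite big1 => [|l lj]; last by rewrite !mxE (negbTE lj) mulr0n mulr0 scale0r.
rewrite big1 ?addr0// => k ki; rewrite big1// => l _.
by rewrite !mxE eq_sym (negbTE ki) mulr0n mul0r scale0r.
Qed.

Lemma mxsandwich1 m p (x : 'M[V]_(m, p)) : mxsandwich 1%:M x 1%:M = x.
Proof.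
by rewrite mxsandwich_scalar mulr1; apply/matrixP => i j; rewrite mxE scale1r.
Qed.

Lemma map_mxsandwich (f : {linear V -> W}) m n p q (a : 'M[C]_(m, n))
    (x : 'M[V]_(n, p)) (b : 'M[C]_(p, q)) :
  map_mx f (mxsandwich a x b) = mxsandwich a (map_mx f x) b.
Proof.
apply/matrixP => i j; rewrite !mxE linear_sum; apply: eq_bigr => k _.
by rewrite linear_sum; apply: eq_bigr => l _; rewrite mxE linearZ.
Qed.

(** Turns a sum into a sandwich of a direct sum; the direct sum estimates for [ruan_min] and
    [pull_bil] rest on it. *)
Lemma mxsandwich_colrow m n p q n' p' (a1 : 'M[C]_(m, n)) (x : 'M[V]_(n, p))
    (b1 : 'M[C]_(p, q)) (a2 : 'M[C]_(m, n')) (y : 'M[V]_(n', p')) (b2 : 'M[C]_(p', q)) :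
  mxsandwich (row_mx a1 a2) (block_mx x 0 0 y) (col_mx b1 b2) =
  mxsandwich a1 x b1 + mxsandwich a2 y b2.
Proof.
apply/matrixP => i j; rewrite !mxE big_split_ord /=; congr (_ + _);
  apply: eq_bigr => k _; rewrite big_split_ord /=.
  rewrite [X in _ + X]big1 ?addr0.
    by apply: eq_bigr => l _; rewrite row_mxEl col_mxEu block_mxEul.
  by move=> l _; rewrite block_mxEur [X in _ *: X]mxE scaler0.
rewrite [X in X + _]big1 ?add0r.
  by apply: eq_bigr => l _; rewrite row_mxEr col_mxEd block_mxEdr.
by move=> l _; rewrite block_mxEdl [X in _ *: X]mxE scaler0.
Qed.

Lemma block_mx_sandwich m n p q (x : 'M[V]_(m, p)) (y : 'M[V]_(n, q)) :
  block_mx x 0 0 y =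
  mxsandwich (col_mx 1%:M 0) x (row_mx 1%:M 0) +
  mxsandwich (col_mx 0 1%:M) y (row_mx 0 1%:M).
Proof.
rewrite -mxsandwich_colrow -{1}[block_mx x 0 0 y]mxsandwich1.
by rewrite -[row_mx (col_mx _ _) _]/(row_mx (col_mx 1%:M 0) (col_mx 0 1%:M))
  -block_mxEh -block_mxEv -!scalar_mx_block.
Qed.

Lemma sandwich_block_ul m n p q (x : 'M[V]_(m, p)) (y : 'M[V]_(n, q)) :
  mxsandwich (row_mx 1%:M 0) (block_mx x 0 0 y) (col_mx 1%:M 0) = x.
Proof.
rewrite mxsandwich_colrow mxsandwich1.
rewrite [X in _ + X](_ : _ = 0) ?addr0//; apply/matrixP => i j; rewrite !mxE.
by rewrite big1// => k _; rewrite big1// => l _; rewrite mxE mul0r scale0r.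
Qed.

Lemma sandwich_block_dr m n p q (x : 'M[V]_(m, p)) (y : 'M[V]_(n, q)) :
  mxsandwich (row_mx 0 1%:M) (block_mx x 0 0 y) (col_mx 0 1%:M) = y.
Proof.
rewrite mxsandwich_colrow mxsandwich1.
rewrite [X in X + _](_ : _ = 0) ?add0r//; apply/matrixP => i j; rewrite !mxE.
by rewrite big1// => k _; rewrite big1// => l _; rewrite mxE mul0r scale0r.
Qed.

Lemma mx_sum_entries m p (x : 'M[V]_(m, p)) :
  x = \sum_i \sum_j mxsandwich (delta_mx i 0) (const_mx (x i j) : 'M_(1, 1)) (delta_mx 0 j).
Proof.
apply/matrixP => i j; rewrite summxE (bigD1 i)//= summxE (bigD1 j)//=.
have E k l : mxsandwich (delta_mx k 0) (const_mx (x k l) : 'M_(1, 1)) (delta_mx 0 l) i j =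
    ((i == k) && (j == l))%:R *: x k l.
  by rewrite !mxE !big_ord1 !mxE !eqxx andbT /= -natrM mulnb.
rewrite E !eqxx scale1r big1 => [|l lj].
  rewrite big1 ?addr0// => k ki; rewrite summxE big1// => l _.
  by rewrite E eq_sym (negbTE ki) scale0r.
by rewrite E eqxx eq_sym (negbTE lj) scale0r.
Qed.

End sandwich_algebra.

Section matrix_seminorms.
Variables (R : realType).
Implicit Types V : lmodType R[i].

(** Homogeneity is a consequence of the sandwich bound, by [mxseminormZ]. *)
Definition mxseminorm V (nu : forall n, 'M[V]_n -> R) :=
  [/\ forall n (x : 'M[V]_n), 0 <= nu n x,
      forall n (x y : 'M[V]_n), nu n (x + y) <= nu n x + nu n y &
      forall m n (a : 'M[R[i]]_(m, n)) (x : 'M[V]_n) (b : 'M[R[i]]_(n, m)),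
        nu m (mxsandwich a x b) <= opnorm a * nu n x * opnorm b].

(** Compression to the corners gives the reverse inequality, by [ruan_dsum]. *)
Definition ruan V (nu : forall n, 'M[V]_n -> R) := mxseminorm nu /\
  forall m n (x : 'M[V]_m) (y : 'M[V]_n),
    nu (m + n)%N (block_mx x 0 0 y) <= Num.max (nu m x) (nu n y).

Section mxseminorm_theory.
Variables (V : lmodType R[i]) (nu : forall n, 'M[V]_n -> R).
Hypothesis hnu : mxseminorm nu.

Lemma mxseminorm_sandwich_le m n (a : 'M[R[i]]_(m, n)) (x : 'M[V]_n) b :
  opnorm a <= 1 -> opnorm b <= 1 -> nu (mxsandwich a x b) <= nu x.
Proof.
case: hnu => h0 _ hM a1 b1; apply: le_trans (hM _ _ _ _ _) _.
apply: (@le_trans _ _ (1 * nu x * 1)); last by rewrite mul1r mulr1.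
by rewrite ler_pM ?mulr_ge0 ?opnorm_ge0// ler_wpM2r.
Qed.

Lemma mxseminormZ_le n c (x : 'M[V]_n) : nu (map_mx ( *:%R c) x) <= absc c * nu x.
Proof.
case: hnu => h0 _ hM; rewrite -[c]mulr1 -mxsandwich_scalar mulr1.
apply: le_trans (hM _ _ _ _ _) _; rewrite -[leRHS]mulr1.
by rewrite ler_pM ?mulr_ge0 ?opnorm_ge0 ?opnorm1// ler_wpM2r// opnorm_scalar.
Qed.

Lemma mxseminorm0 n : nu (0 : 'M[V]_n) = 0.
Proof.
apply/le_anti; case: (hnu) => h0 _ _; rewrite h0 andbT.
have := mxseminormZ_le 0 (0 : 'M[V]_n); rewrite absc0 mul0r.
by have -> : map_mx ( *:%R 0) (0 : 'M[V]_n) = 0 by apply/matrixP => i j; rewrite !mxE scaler0.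
Qed.

Lemma mxseminormZ n c (x : 'M[V]_n) : nu (map_mx ( *:%R c) x) = absc c * nu x.
Proof.
have [->|c0] := eqVneq c 0.
  have -> : map_mx ( *:%R 0) x = 0 by apply/matrixP => i j; rewrite !mxE scale0r.
  by rewrite mxseminorm0 absc0 mul0r.
apply/le_anti; rewrite mxseminormZ_le /=.
have a0 : 0 < absc c by rewrite lt_def absc_eq0 c0 absc_ge0.
rewrite -ler_pdivlMl//.
have {1}-> : x = map_mx ( *:%R c^-1) (map_mx ( *:%R c) x).
  by apply/matrixP => i j; rewrite !mxE scalerA mulVf// scale1r.
apply: le_trans (mxseminormZ_le _ _) _; rewrite ler_wpM2r//; first by case: hnu.
have -> // : absc c^-1 = (absc c)^-1.
have cn : absc c != 0 by rewrite gt_eqF.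
by apply: (mulfI cn); rewrite -abscM !mulfV// absc1.
Qed.

Lemma mxseminorm_sum (I : Type) (s : seq I) n (f : I -> 'M[V]_n) :
  nu (\sum_(i <- s) f i) <= \sum_(i <- s) nu (f i).
Proof.
elim/big_rec2: _ => [|i y x _ h]; first by rewrite mxseminorm0.
case: hnu => _ hD _; apply: le_trans (hD _ _ _) _.
by rewrite lerD2l.
Qed.

Lemma mxseminorm_entries n (x : 'M[V]_n) :
  nu x <= \sum_i \sum_j nu (const_mx (x i j) : 'M_1).
Proof.
rewrite {1}[x]mx_sum_entries; apply: le_trans (mxseminorm_sum _ _) _.
apply: ler_sum => i _; apply: le_trans (mxseminorm_sum _ _) _.
apply: ler_sum => j _; apply: mxseminorm_sandwich_le.
  by apply: le_trans (opnorm_col _) _; rewrite l2norm_delta.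
by rewrite -trmx_delta; apply: le_trans (opnorm_colT _) _; rewrite l2norm_delta.
Qed.

End mxseminorm_theory.

Lemma ruan_dsum V (nu : forall n, 'M[V]_n -> R) m n (x : 'M[V]_m) (y : 'M[V]_n) :
  ruan nu -> nu (m + n)%N (block_mx x 0 0 y) = Num.max (nu m x) (nu n y).
Proof.
move=> [hnu hd]; apply/le_anti; rewrite hd ge_max /=; apply/andP; split.
  rewrite -{1}(sandwich_block_ul x y); apply: mxseminorm_sandwich_le => //.
    exact: opnorm_row_mx01.
  exact: opnorm_col_mx01.
rewrite -{1}(sandwich_block_dr x y); apply: mxseminorm_sandwich_le => //.
  exact: opnorm_row_mx10.
exact: opnorm_col_mx10.
Qed.

Lemma mxnorm_ruan (E : opSpaceType R) : ruan (fun n (x : 'M[E]_n) => mxnorm x).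
Proof.
split; last by move=> m n x y; rewrite mxnorm_dsum.
split; [|exact: mxnormD|exact: mxnormM] => n x.
have := mxnormD n x (map_mx ( *:%R (-1)) x).
have -> : x + map_mx ( *:%R (-1)) x = map_mx ( *:%R 0) x.
  by apply/matrixP => i j; rewrite !mxE scaleN1r subrr scale0r.
by rewrite !mxnormZ absc0 abscN absc1 mul0r mul1r; lra.
Qed.

Lemma l2_mxseminorm V (nu : nat -> forall n, 'M[V]_n -> R) (s : seq nat) :
  (forall k, mxseminorm (nu k)) ->
  mxseminorm (fun n x => l2 s xpredT (fun k => nu k n x)).
Proof.
move=> h; split=> [n x|n x y|m n a x b]; first exact: l2_ge0.
  apply: le_trans (l2D _ _ _ _).
  by apply: le_l2 => k _; have [h0 hD _] := h k; rewrite h0 hD.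
rewrite mulrAC -l2Z ?mulr_ge0 ?opnorm_ge0//.
by apply: le_l2 => k _; have [h0 _ hM] := h k; rewrite h0 /= mulrAC.
Qed.

(** * Minimal operator space structures *)

Section minimal_structure.
Variables (V : lmodType R[i]) (p : forall n, 'M[V]_n -> R).
Hypothesis hp : mxseminorm p.

(** The structure MIN of the level-1 space: exchanging suprema, this is the supremum of the operator
    norms of (phi (x i j)) over the functionals phi dominated by [p] at level 1. *)
Definition ruan_min n (x : 'M[V]_n) : R :=
  sup [set r | exists a b : 'cV[R[i]]_n,
    [/\ l2norm a <= 1, l2norm b <= 1 & r = p (mxsandwich a^T x b)]].

Lemma ruan_min_ubound n (x : 'M[V]_n) a b : l2norm a <= 1 -> l2norm b <= 1 ->
  p (mxsandwich a^T x b) <= p x.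
Proof.
move=> a1 b1; apply: mxseminorm_sandwich_le => //.
  exact: le_trans (opnorm_colT _) _.
exact: le_trans (opnorm_col _) _.
Qed.

Lemma le_ruan_min1 n (x : 'M[V]_n) a b : l2norm a <= 1 -> l2norm b <= 1 ->
  p (mxsandwich a^T x b) <= ruan_min x.
Proof.
move=> a1 b1; apply: ub_le_sup; last by exists a, b.
by exists (p x) => _ [a' [b' [? ? ->]]]; exact: ruan_min_ubound.
Qed.

Lemma ruan_min_le n (x : 'M[V]_n) r :
  (forall a b, l2norm a <= 1 -> l2norm b <= 1 -> p (mxsandwich a^T x b) <= r) ->
  ruan_min x <= r.
Proof.
move=> h; apply: ge_sup; last by move=> _ [a [b [a1 b1 ->]]]; exact: h.
by exists (p (mxsandwich (0 : 'cV_n)^T x (0 : 'cV_n))), 0, 0; rewrite l2norm0.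
Qed.

Lemma ruan_min_le_self n (x : 'M[V]_n) : ruan_min x <= p x.
Proof. by apply: ruan_min_le => a b; exact: ruan_min_ubound. Qed.

Lemma ruan_min_ge0 n (x : 'M[V]_n) : 0 <= ruan_min x.
Proof.
have [h0 _ _] := hp.
by apply: le_trans (@le_ruan_min1 _ x 0 0 _ _); rewrite ?l2norm0.
Qed.

Lemma le_ruan_min n (x : 'M[V]_n) a b :
  p (mxsandwich a^T x b) <= l2norm a * l2norm b * ruan_min x.
Proof.
have [/l2norm_eq0 ->|a0] := eqVneq (l2norm a) 0.
  rewrite l2norm0 !mul0r.
  have -> : mxsandwich (0 : 'cV_n)^T x b = 0.
    apply/matrixP => i j; rewrite !mxE big1// => k _; rewrite big1// => l _.
    by rewrite !mxE mul0r scale0r.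
  by rewrite mxseminorm0.
have [/l2norm_eq0 ->|b0] := eqVneq (l2norm b) 0.
  rewrite l2norm0 mulr0 mul0r.
  have -> : mxsandwich a^T x (0 : 'cV_n) = 0.
    apply/matrixP => i j; rewrite !mxE big1// => k _; rewrite big1// => l _.
    by rewrite !mxE mulr0 scale0r.
  by rewrite mxseminorm0.
have {}a0 : 0 < l2norm a by rewrite lt_def a0 l2norm_ge0.
have {}b0 : 0 < l2norm b by rewrite lt_def b0 l2norm_ge0.
have := @le_ruan_min1 _ x ((l2norm a)^-1%:C *: a) ((l2norm b)^-1%:C *: b).
rewrite !l2normZ !absc_real !gtr0_norm ?invr_gt0// !mulVf ?gt_eqF//.
move=> /(_ (lexx _) (lexx _)).
have -> : mxsandwich ((l2norm a)^-1%:C *: a)^T x ((l2norm b)^-1%:C *: b) =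
    map_mx ( *:%R ((l2norm a)^-1 * (l2norm b)^-1)%:C) (mxsandwich a^T x b).
  apply/matrixP => i j; rewrite !mxE scaler_sumr; apply: eq_bigr => k _.
  rewrite scaler_sumr; apply: eq_bigr => l _; rewrite scalerA !mxE rmorphM /=.
  by congr (_ *: _); ring.
rewrite mxseminormZ// absc_real gtr0_norm ?mulr_gt0 ?invr_gt0//.
by rewrite -invfM ler_pdivrMl ?mulr_gt0.
Qed.

Lemma ruan_min_ruan : ruan ruan_min.
Proof.
have [h0 hD hM] := hp.
have tr m n (a : 'M[R[i]]_(m, n)) (c : 'cV_m) : c^T *m a = (a^T *m c)^T.
  by rewrite trmx_mul trmxK.
split; first split=> [n x|n x y|m n a x b]; first exact: ruan_min_ge0.
- apply: ruan_min_le => c d c1 d1; rewrite mxsandwichD.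
  by apply: le_trans (hD _ _ _) _; apply: lerD; exact: le_ruan_min1.
- apply: ruan_min_le => c d c1 d1; rewrite mxsandwichM tr.
  apply: le_trans (le_ruan_min _ _ _) _; rewrite [leRHS]mulrAC.
  rewrite ler_wpM2r ?ruan_min_ge0// ler_pM ?l2norm_ge0//.
    apply: le_trans (l2norm_mulmx _ _) _.
    by rewrite opnorm_tr ler_piMr ?opnorm_ge0.
  apply: le_trans (l2norm_mulmx _ _) _.
  by rewrite ler_piMr ?opnorm_ge0.
move=> m n x y; apply: ruan_min_le => a b.
rewrite -[a]vsubmxK -[b]vsubmxK.
move: (usubmx a) (dsubmx a) (usubmx b) (dsubmx b) => a1 a2 b1 b2 {a b} ha hb.
rewrite tr_col_mx mxsandwich_colrow; apply: le_trans (hD _ _ _) _.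
apply: le_trans (lerD (le_ruan_min _ _ _) (le_ruan_min _ _ _)) _.
set M := Num.max _ _.
have xM : ruan_min x <= M by rewrite le_max lexx.
have yM : ruan_min y <= M by rewrite le_max lexx orbT.
have M0 : 0 <= M by apply: le_trans xM; exact: ruan_min_ge0.
have ha' : l2norm a1 ^+ 2 + l2norm a2 ^+ 2 <= 1.
  by rewrite -l2norm_col_mx exprn_ile1// l2norm_ge0.
have hb' : l2norm b1 ^+ 2 + l2norm b2 ^+ 2 <= 1.
  by rewrite -l2norm_col_mx exprn_ile1// l2norm_ge0.
apply: (@le_trans _ _ ((l2norm a1 * l2norm b1 + l2norm a2 * l2norm b2) * M)).
  by rewrite mulrDl; apply: lerD; rewrite ler_wpM2l ?mulr_ge0 ?l2norm_ge0.
(* The coefficient is at most half the sum of the four squares, hence at most 1. *)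
rewrite ler_piMl//.
have := sqr_ge0 (l2norm a1 - l2norm b1); have := sqr_ge0 (l2norm a2 - l2norm b2).
by rewrite !sqrrB; lra.
Qed.

Lemma ruan_min1 (x : V) : p (const_mx x : 'M_1) <= ruan_min (const_mx x : 'M_1).
Proof.
have h : l2norm (1%:M : 'cV[R[i]]_1) <= 1.
  by rewrite /l2norm big_ord1 mxE eqxx absc1 expr1n sqrtr1.
by apply: le_trans (le_ruan_min1 _ h h); rewrite trmx1 mxsandwich1.
Qed.

End minimal_structure.

(* The largest operator space structure dominated by all the matrix seminorms
   [P N]; it exists because a supremum of such structures is again one. *)
Section ruan_hull.
Variables (V : lmodType R[i]) (P : nat -> forall n, 'M[V]_n -> R).
Hypotheses (hP : forall N, mxseminorm (P N))
  (Pbnd : forall x : V, exists r, forall N, P N (const_mx x : 'M_1) <= r).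

(** The second clause says that [nu] is at most the supremum over N of [P N], phrased through upper
    bounds. *)
Definition admissible (nu : forall n, 'M[V]_n -> R) := ruan nu /\
  forall n (x : 'M[V]_n) r, (forall N, P N x <= r) -> nu n x <= r.

Definition ruan_hull n (x : 'M[V]_n) : R :=
  sup [set r | exists2 nu, admissible nu & r = nu n x].

Lemma mx_bounded n (x : 'M[V]_n) : exists r, forall N, P N x <= r.
Proof.
have [r hr] := choice Pbnd; exists (\sum_i \sum_j r (x i j)) => N.
apply: le_trans (mxseminorm_entries (hP N) x) _.
by apply: ler_sum => i _; apply: ler_sum => j _; exact: hr.
Qed.

Lemma admissible_le_hull nu n (x : 'M[V]_n) : admissible nu -> nu n x <= ruan_hull x.
Proof.
move=> hnu; apply: ub_le_sup; last by exists nu.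
by have [r hr] := mx_bounded x; exists r => _ [nu' [_ h] ->]; exact: h.
Qed.

Lemma hull_le n (x : 'M[V]_n) r :
  (forall nu, admissible nu -> nu n x <= r) -> ruan_hull x <= r.
Proof.
move=> h; apply: ge_sup; last by move=> _ [nu hnu ->]; exact: h.
(* The zero structure is admissible, so the supremum is over a nonempty set. *)
exists 0, (fun n (x : 'M[V]_n) => 0) => //; split.
  split; last by move=> *; rewrite maxxx.
  by split=> [//|*|*]; rewrite ?addr0// mulr0 mul0r.
by move=> m y s /(_ 0%N); apply: le_trans; have [] := hP 0.
Qed.

Lemma hull_admissible : admissible ruan_hull.
Proof.
have hull0 n (x : 'M[V]_n) : 0 <= ruan_hull x.
  have h : admissible (ruan_min (P 0)).
    split; first exact: ruan_min_ruan.
    by move=> m y r /(_ 0%N); apply: le_trans; exact: ruan_min_le_self.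
  by apply: le_trans (admissible_le_hull x h); exact: ruan_min_ge0.
split; last by move=> n x r h; apply: hull_le => nu [_]; apply.
split; first split=> // [n x y|m n a x b].
- apply: hull_le => nu hnu; have [[[_ hD _] _] _] := hnu.
  by apply: le_trans (hD _ _ _) _; apply: lerD; exact: admissible_le_hull.
- apply: hull_le => nu hnu; have [[[h0 _ hM] _] _] := hnu.
  apply: le_trans (hM _ _ _ _ _) _.
  by rewrite ler_wpM2r ?opnorm_ge0// ler_wpM2l ?opnorm_ge0// admissible_le_hull.
- move=> m n x y; apply: hull_le => nu hnu; have [[_ hd] _] := hnu.
  apply: le_trans (hd _ _ _ _) _.
  by rewrite ge_max !le_max !admissible_le_hull// orbT.
Qed.

(** The hull loses nothing at level 1: each [ruan_min (P N)] is admissible and agrees with [P N]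
    there. *)
Lemma hull1P (x : V) r :
  ruan_hull (const_mx x : 'M_1) <= r <-> forall N, P N (const_mx x : 'M_1) <= r.
Proof.
split=> [h N|]; last exact: hull_admissible.2.
apply: le_trans h; apply: le_trans (ruan_min1 (hP N) x) _.
apply: admissible_le_hull; split; first exact: ruan_min_ruan.
by move=> m y s /(_ N); apply: le_trans; exact: ruan_min_le_self.
Qed.

End ruan_hull.

End matrix_seminorms.

(** * Tensor products, bilinear actions and the K-functional *)

Section tensor_identity.
Variable R : realType.
Implicit Types p m n : nat.

Lemma sum_tens_index (S : nmodType) p n (f : 'I_(p * n) -> S) :
  \sum_i f i = \sum_k \sum_j f (mxtens_index (k, j)).
Proof.
rewrite pair_big /= (reindex (@mxtens_index p n)) /=.
  by apply: eq_bigr => -[k j] _.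
by exists (@mxtens_unindex p n) => i _; rewrite ?mxtens_indexK ?mxtens_unindexK.
Qed.

(** The blocks of a vector in the tensor product of C^p and C^n; the matrix 1 tensor c acts on each
    of them by c. *)
Definition tens_slice p n (y : 'cV[R[i]]_(p * n)) (k : 'I_p) : 'cV[R[i]]_n :=
  \col_j y (mxtens_index (k, j)) 0.

Lemma tens_slice_mul p m n (c : 'M[R[i]]_(m, n)) (y : 'cV[R[i]]_(p * n)) k :
  tens_slice ((1%:M *t c) *m y) k = c *m tens_slice y k.
Proof.
apply/matrixP => i j; rewrite !mxE sum_tens_index (bigD1 k)//=.
rewrite [X in _ + X]big1 ?addr0 => [|l lk]; last first.
  by rewrite big1// => s _; rewrite tensmxE !mxE eq_sym (negbTE lk) mul0r mul0r.
by apply: eq_bigr => s _; rewrite tensmxE !mxE eqxx mul1r.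
Qed.

Lemma l2norm_slices p n (y : 'cV[R[i]]_(p * n)) :
  l2norm y ^+ 2 = \sum_k l2norm (tens_slice y k) ^+ 2.
Proof.
rewrite l2norm_sqr sum_tens_index; apply: eq_bigr => k _.
by rewrite l2norm_sqr; apply: eq_bigr => j _; rewrite mxE.
Qed.

Lemma opnorm_tens1 p m n (c : 'M[R[i]]_(m, n)) :
  opnorm ((1%:M : 'M_p) *t c) <= opnorm c.
Proof.
apply: opnorm_le => [|y]; first exact: opnorm_ge0.
rewrite -(@ler_pXn2r _ 2) ?nnegrE ?l2norm_ge0 ?mulr_ge0 ?opnorm_ge0 ?l2norm_ge0//.
rewrite exprMn !l2norm_slices mulr_sumr; apply: ler_sum => k _.
rewrite tens_slice_mul -exprMn ler_pXn2r ?nnegrE ?l2norm_ge0 ?mulr_ge0 ?opnorm_ge0 ?l2norm_ge0//.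
exact: l2norm_mulmx.
Qed.

(** The matrix is the permutation that distributes C^p over the direct sum of C^m and C^n. *)
Lemma opnorm_tens_col_mx p m n :
  opnorm (col_mx ((1%:M : 'M[R[i]]_p) *t (row_mx 1%:M 0 : 'M_(m, m + n)))
                 ((1%:M : 'M_p) *t (row_mx 0 1%:M : 'M_(n, m + n)))) <= 1.
Proof.
apply: opnorm_le => // y; rewrite mul1r mul_col_mx.
rewrite -(@ler_pXn2r _ 2) ?nnegrE ?l2norm_ge0// l2norm_col_mx !l2norm_slices.
rewrite -big_split /=; apply: ler_sum => k _; rewrite !tens_slice_mul.
rewrite -[tens_slice y k]vsubmxK !mul_row_col !mul1mx !mul0mx addr0 add0r.
by rewrite l2norm_col_mx.
Qed.

Lemma opnorm_tens_row_mx p m n :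
  opnorm (row_mx ((1%:M : 'M[R[i]]_p) *t (col_mx 1%:M 0 : 'M_(m + n, m)))
                 ((1%:M : 'M_p) *t (col_mx 0 1%:M : 'M_(m + n, n)))) <= 1.
Proof.
rewrite -opnorm_tr tr_row_mx !trmx_tens !tr_col_mx !trmx1 !trmx0.
exact: opnorm_tens_col_mx.
Qed.

End tensor_identity.

Section matrix_bilinear.
Variables (R : realType) (A E G : lmodType R[i]).
Implicit Type b : {bilinear A -> E -> G}.

Definition mxbil (b : A -> E -> G) p q (v : 'M[A]_p) (x : 'M[E]_q) : 'M[G]_(p * q) :=
  \matrix_(i, j) b (v (mxtens_unindex i).1 (mxtens_unindex j).1)
                   (x (mxtens_unindex i).2 (mxtens_unindex j).2).

Lemma mxbilDr b p q (v : 'M[A]_p) (x y : 'M[E]_q) :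
  mxbil b v (x + y) = mxbil b v x + mxbil b v y.
Proof. by apply/matrixP => i j; rewrite !mxE linearDr. Qed.

Lemma mxbil_sandwich b p m n (v : 'M[A]_p) (c : 'M[R[i]]_(m, n)) (x : 'M[E]_n)
    (d : 'M[R[i]]_(n, m)) :
  mxbil b v (mxsandwich c x d) =
  mxsandwich (1%:M *t c) (mxbil b v x) (1%:M *t d).
Proof.
apply/matrixP => i j; rewrite !mxE.
case: (mxtens_indexP i) => i1 i2; case: (mxtens_indexP j) => j1 j2.
rewrite !mxtens_indexK /= sum_tens_index (bigD1 i1)//=.
rewrite [X in _ + X]big1 ?addr0 => [|k ki]; last first.
  rewrite big1// => s _; rewrite big1// => l _.
  by rewrite tensmxE !mxE eq_sym (negbTE ki) !mul0r scale0r.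
rewrite linear_sumr; apply: eq_bigr => k _.
rewrite sum_tens_index (bigD1 j1)//=.
rewrite [X in _ + X]big1 ?addr0 => [|l lj]; last first.
  rewrite big1// => s _.
  by rewrite !tensmxE !mxE (negbTE lj) mul0r mulr0 scale0r.
rewrite linear_sumr; apply: eq_bigr => l _.
by rewrite linearZr_LR !tensmxE !mxE !mxtens_indexK /= !eqxx !mul1r.
Qed.

End matrix_bilinear.

Section pullback.
Variables (R : realType) (A E G : lmodType R[i]) (b : {bilinear A -> E -> G}).
Variables (p : nat) (v : 'M[A]_p) (nu : forall n, 'M[G]_n -> R) (t : R).

Definition pull_bil n (x : 'M[E]_n) : R := t^-1 * nu (mxbil b v x).

Lemma pull_bil_mxseminorm : 0 < t -> mxseminorm nu -> mxseminorm pull_bil.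
Proof.
move=> t0 hnu; have [h0 hD hM] := hnu; rewrite /pull_bil.
have t1 : 0 <= t^-1 by rewrite invr_ge0 ltW.
split=> [n x|n x y|m n c x d]; first by rewrite mulr_ge0.
  by rewrite mxbilDr -mulrDr ler_wpM2l.
rewrite mxbil_sandwich mulrCA -mulrA ler_wpM2l//.
apply: le_trans (hM _ _ _ _ _) _.
by rewrite ler_pM ?mulr_ge0 ?opnorm_ge0 ?opnorm_tens1// ler_wpM2r ?opnorm_tens1.
Qed.

Lemma pull_bil_ruan : 0 < t -> ruan nu -> ruan pull_bil.
Proof.
move=> t0 [hnu hd]; split; first exact: pull_bil_mxseminorm.
have t1 : 0 <= t^-1 by rewrite invr_ge0 ltW.
move=> m n x y; rewrite /pull_bil -maxr_pMr// ler_wpM2l//.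
apply: le_trans (hd _ _ _ _).
(* Up to that permutation, amplifying a direct sum by [v] gives the direct sum of the
   amplifications. *)
rewrite block_mx_sandwich mxbilDr !mxbil_sandwich -mxsandwich_colrow.
apply: mxseminorm_sandwich_le => //; first exact: opnorm_tens_row_mx.
exact: opnorm_tens_col_mx.
Qed.

End pullback.

(** * Factorisation of matrices over a tensor product *)

Section tensor_factorisation.
Variables (R : realType) (A E : lmodType R[i]).
Local Open Scope quotient_scope.

Lemma tens0l (y : E) : tens (0 : A) y = 0.
Proof.
rewrite -[RHS]/(\pi_(tensor A E) [::]); apply/tensorP => W b.
by rewrite /fsum_eval big_seq1 big_nil /= linear0l.
Qed.

Lemma tensor_sum (t : tensor A E) : t = \sum_(p <- repr t) tens p.1 p.2.
Proof.
rewrite -{1}[t]reprK; elim: (repr t) => [|p u IH]; first by rewrite big_nil.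
rewrite big_cons -IH -[RHS]/(\pi_(tensor A E) (repr (tens p.1 p.2) ++ repr (\pi_(tensor A E) u))).
apply/tensorP => W b; rewrite fsum_eval_cat !fsum_eval_repr /fsum_eval.
by rewrite big_cons big_seq1.
Qed.

(** Coefficients are kept as products of a row factor and a column factor, ready to become the outer
    matrices of [tensor_factor]. *)
Lemma tensor_mx_sum n (u : 'M[tensor A E]_n) :
  exists s : seq (('I_n -> R[i]) * ('I_n -> R[i]) * (A * E)), forall i j,
    u i j = \sum_(w <- s) (w.1.1 i * w.1.2 j) *: tens w.2.1 w.2.2.
Proof.
pose Q (u : 'M[tensor A E]_n) :=
  exists s : seq (('I_n -> R[i]) * ('I_n -> R[i]) * (A * E)), forall i j,
    u i j = \sum_(w <- s) (w.1.1 i * w.1.2 j) *: tens w.2.1 w.2.2.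
have Q0 : Q 0 by exists [::] => i j; rewrite big_nil mxE.
have QD x y : Q x -> Q y -> Q (x + y).
  move=> [s hs] [s' hs']; exists (s ++ s') => i j.
  by rewrite big_cat mxE hs hs'.
have -> : u = \sum_i \sum_j \matrix_(k, l) (((k == i)%:R * (l == j)%:R) *: u i j).
  apply/matrixP => i j; rewrite summxE (bigD1 i)//= summxE (bigD1 j)//= !mxE !eqxx.
  rewrite mulr1 scale1r big1 => [|l lj].
    rewrite big1 ?addr0// => k ki; rewrite summxE big1// => l _.
    by rewrite mxE eq_sym (negbTE ki) mul0r scale0r.
  by rewrite mxE [j == _]eq_sym (negbTE lj) mulr0 scale0r.
apply: (big_ind Q) => // i _; apply: (big_ind Q) => // j _.
exists [seq ((fun k : 'I_n => (k == i)%:R, fun l : 'I_n => (l == j)%:R), p) | p <- repr (u i j)].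
move=> k l; rewrite mxE {1}[u i j]tensor_sum scaler_sumr big_map.
by [].
Qed.

End tensor_factorisation.

Section projective_norm.
Variables (R : realType) (A E : opSpaceType R).

(** [v] and [w] are diagonal, carrying the tensor factors of a list of elementary tensors, and [a],
    [b] are supported on the index pairs (k, k). This makes [projnorm] an infimum over a nonempty
    set. *)
Lemma tensor_factor n (u : 'M[tensor A E]_n) :
  exists L (a : 'M[R[i]]_(n, L * L)) (v : 'M[A]_L) (w : 'M[E]_L) (b : 'M[R[i]]_(L * L, n)),
    u = mxsandwich a (mxtens v w) b.
Proof.
have [s hs] := tensor_mx_sum u.
pose f (k : 'I_(size s)) := tnth (in_tuple s) k.
pose a : 'M[R[i]]_(n, _) := \matrix_(i, k) if (mxtens_unindex k).1 == (mxtens_unindex k).2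
   then (f (mxtens_unindex k).1).1.1 i else 0.
pose b : 'M[R[i]]_(_, n) := \matrix_(k, j) if (mxtens_unindex k).1 == (mxtens_unindex k).2
   then (f (mxtens_unindex k).1).1.2 j else 0.
pose v := \matrix_(k, l) if k == l then (f k).2.1 else 0.
pose w := \matrix_(k, l) if k == l then (f k).2.2 else 0.
exists (size s), a, v, w, b.
have aE i k l : a i (mxtens_index (k, l)) = if k == l then (f k).1.1 i else 0.
  by rewrite mxE mxtens_indexK.
have bE i k l : b (mxtens_index (k, l)) i = if k == l then (f k).1.2 i else 0.
  by rewrite mxE mxtens_indexK.
apply/matrixP => i j; rewrite hs [RHS]mxE -[s]/(tval (in_tuple s)) big_tuple.
rewrite sum_tens_index; apply: eq_bigr => k _.
rewrite (bigD1 k)//= [X in _ = _ + X]big1 ?addr0 => [|k' kk']; last first.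
  by rewrite big1// => l _; rewrite aE eq_sym (negbTE kk') mul0r scale0r.
rewrite sum_tens_index (bigD1 k)//= [X in _ = _ + X]big1 ?addr0 => [|l lk]; last first.
  rewrite big1// => l' _.
  have vkl : v k l = 0 by rewrite mxE eq_sym (negbTE lk).
  by rewrite [X in _ *: X]mxE !mxtens_indexK /= vkl tens0l scaler0.
rewrite (bigD1 k)//= [X in _ = _ + X]big1 ?addr0 => [|l lk]; last first.
  by rewrite bE eq_sym (negbTE lk) mulr0 scale0r.
by rewrite aE bE !mxE !mxtens_indexK /= !eqxx.
Qed.

Variables (G : opSpaceType R) (b : {bilinear A -> E -> G}).

Lemma map_mxtens (m : {linear tensor A E -> G}) :
  (forall x y, m (tens x y) = b x y) ->
  forall p q (v : 'M[A]_p) (w : 'M[E]_q), map_mx m (mxtens v w) = mxbil b v w.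
Proof. by move=> h p q v w; apply/matrixP => i j; rewrite !mxE h. Qed.

(** The projective norm linearises jointly completely contractive bilinear maps. Identity outer
    matrices give one direction, the sandwich bound in [G] the other; module actions are handled in
    this form below. *)
Lemma extends_ccP : extends_cc b <->
  forall p q (v : 'M[A]_p) (w : 'M[E]_q), mxnorm (mxbil b v w) <= mxnorm v * mxnorm w.
Proof.
have [[_A _ _] _] := mxnorm_ruan A; have [[_E _ _] _] := mxnorm_ruan E.
split=> [[m [mb mn]] p q v w|h].
  rewrite -(map_mxtens mb); apply: le_trans (mn _ _) _.
  apply: (@le_trans _ _ (opnorm (1%:M : 'M[R[i]]_(p * q)) * mxnorm v * mxnorm w *
    opnorm (1%:M : 'M[R[i]]_(p * q)))).
    apply: ge_inf.
      by exists 0 => _ [? [? [? [? [? [? [_ ->]]]]]]]; rewrite !mulr_ge0// opnorm_ge0.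
    by exists p, q, 1%:M, v, w, 1%:M; rewrite mxsandwich1.
  rewrite -(mulrA (opnorm _)) -[leRHS]mulr1 ler_pM ?mulr_ge0 ?opnorm_ge0 ?opnorm1//.
  by rewrite ler_piMl ?mulr_ge0 ?opnorm1.
have [m mb] := tensor_univ b; exists m; split=> // n u.
apply: lb_le_inf.
  have [L [a [v [w [c ->]]]]] := tensor_factor u.
  by exists (opnorm a * mxnorm v * mxnorm w * opnorm c), L, L, a, v, w, c.
move=> _ [p [q [a [v [w [c [-> ->]]]]]]].
rewrite map_mxsandwich (map_mxtens mb).
apply: le_trans (mxnormM _ _ _ _ _) _.
by rewrite -(mulrA (opnorm a) (mxnorm v)) ler_wpM2r ?opnorm_ge0// ler_wpM2l ?opnorm_ge0.
Qed.

End projective_norm.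

Section opspace.
Variable R : realType.
Implicit Types E F : opSpaceType R.

Lemma mxnorm_rnorm E (x : E) : mxnorm (const_mx x : 'M_1) = rnorm x.
Proof. by apply: complexI; rewrite mxnorm1 rnormC. Qed.

Lemma mxnorm_ge0 E n (x : 'M[E]_n) : 0 <= mxnorm x.
Proof. by have [[h _ _] _] := mxnorm_ruan E. Qed.

Lemma cbnorm_le E F (T : {linear E -> F}) (c : R) : 0 <= c ->
  (cbnorm T <= c%:E)%E <->
  forall n (x : 'M[E]_n), mxnorm (map_mx T x) <= c * mxnorm x.
Proof.
move=> c0; split=> [h n x|h].
  have hT (y : 'M[E]_n) : mxnorm y <= 1 -> mxnorm (map_mx T y) <= c.
    move=> y1; rewrite -lee_fin; apply: le_trans h; apply: ereal_sup_ubound.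
    by exists n, y.
  have [/mxnorm_eq0 ->|x0] := eqVneq (mxnorm x) 0.
    have -> : map_mx T (0 : 'M_n) = 0 by apply/matrixP => i j; rewrite !mxE linear0.
    by rewrite (mxseminorm0 (mxnorm_ruan F).1) mulr_ge0// mxnorm_ge0.
  have {}x0 : 0 < mxnorm x by rewrite lt_def x0 mxnorm_ge0.
  have := hT (map_mx ( *:%R (mxnorm x)^-1%:C) x).
  have -> : map_mx T (map_mx ( *:%R (mxnorm x)^-1%:C) x) =
      map_mx ( *:%R (mxnorm x)^-1%:C) (map_mx T x).
    by apply/matrixP => i j; rewrite !mxE linearZ.
  rewrite !mxnormZ absc_real gtr0_norm ?invr_gt0// mulVf ?gt_eqF// => /(_ (lexx _)).
  by rewrite ler_pdivrMl// mulrC.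
apply: ge_ereal_sup => _ [n [x [x1 ->]]]; rewrite lee_fin.
by apply: le_trans (h n x) _; rewrite ler_piMr.
Qed.

Lemma cbnorm_ge0 E F (T : {linear E -> F}) : (0 <= cbnorm T)%E.
Proof.
apply: ereal_sup_ubound; exists 1%N, 0.
have -> : map_mx T (0 : 'M_1) = 0 by apply/matrixP => i j; rewrite !mxE linear0.
by rewrite !(mxseminorm0 (mxnorm_ruan _).1).
Qed.

Lemma completely_bounded_norm E F (T : {linear E -> F}) : completely_bounded T ->
  exists c, [/\ 0 <= c, cbnorm T = c%:E &
    forall n (x : 'M[E]_n), mxnorm (map_mx T x) <= c * mxnorm x].
Proof.
rewrite /completely_bounded => h.
have E0 : cbnorm T = (fine (cbnorm T))%:E.
  by rewrite fineK// ge0_fin_numE// cbnorm_ge0.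
have c0 : 0 <= fine (cbnorm T) by rewrite fine_ge0// cbnorm_ge0.
exists (fine (cbnorm T)); split=> //.
by apply/(cbnorm_le _ c0); rewrite -E0.
Qed.

End opspace.

(** * K-functionals at all matrix levels *)

Section K_functional.
Variables (R : realType) (E F : opSpaceType R) (T : {linear E -> F}) (a b : R).
Hypotheses (a0 : 0 <= a) (b0 : 0 <= b).

(** Peetre's K-functional at matrix level n. For positive [a] and [b] it is at level 1, up to a
    factor 2, the gauge of 1/a T(ball E) + 1/b ball F. *)
Definition Kfun n (x : 'M[F]_n) : R :=
  inf [set a * mxnorm u + b * mxnorm (x - map_mx T u) | u in [set: 'M[E]_n]].

Lemma Kfun_le n (x : 'M[F]_n) (u : 'M[E]_n) :
  Kfun x <= a * mxnorm u + b * mxnorm (x - map_mx T u).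
Proof.
apply: ge_inf; last by exists u.
by exists 0 => _ [w _ <-]; rewrite addr_ge0// mulr_ge0// mxnorm_ge0.
Qed.

Lemma le_Kfun n (x : 'M[F]_n) r :
  (forall u : 'M[E]_n, r <= a * mxnorm u + b * mxnorm (x - map_mx T u)) -> r <= Kfun x.
Proof.
move=> h; apply: lb_le_inf; last by move=> _ [u _ <-]; exact: h.
by exists (a * mxnorm (0 : 'M[E]_n) + b * mxnorm (x - map_mx T 0)), 0.
Qed.

Lemma Kfun_ge0 n (x : 'M[F]_n) : 0 <= Kfun x.
Proof. by apply: le_Kfun => u; rewrite addr_ge0// mulr_ge0// mxnorm_ge0. Qed.

Lemma Kfun_lt n (x : 'M[F]_n) r : Kfun x < r ->
  exists u : 'M[E]_n, a * mxnorm u + b * mxnorm (x - map_mx T u) < r.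
Proof.
move=> h; apply: contrapT => /forallNP hn.
move: h; rewrite ltNge => /negP; apply; apply: le_Kfun => u.
by rewrite leNgt; apply/negP; exact: hn.
Qed.

Lemma Kfun_mxseminorm : mxseminorm Kfun.
Proof.
split=> [n x|n x y|m n c x d]; first exact: Kfun_ge0.
  rewrite -lerBlDr; apply: le_Kfun => u; rewrite lerBlDr -lerBlDl.
  apply: le_Kfun => w; rewrite lerBlDl; apply: le_trans (Kfun_le _ (u + w)) _.
  have -> : x + y - map_mx T (u + w) = (x - map_mx T u) + (y - map_mx T w).
    by apply/matrixP => i j; rewrite !mxE linearD opprD addrACA.
  rewrite [leRHS]addrACA -!mulrDr; apply: lerD; rewrite ler_wpM2l//; exact: mxnormD.
(* The general case divides by this product. If it vanishes, u = 0 and the sandwich bound in [F]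
   give 0. *)
rewrite mulrAC; have [cd0|cd0] := eqVneq (opnorm c * opnorm d) 0.
  rewrite cd0 mul0r; apply: le_trans (Kfun_le _ 0) _.
  have -> : mxsandwich c x d - map_mx T 0 = mxsandwich c x d.
    by apply/matrixP => i j; rewrite !mxE linear0 subr0.
  rewrite (mxseminorm0 (mxnorm_ruan E).1) mulr0 add0r.
  apply: le_trans (ler_wpM2l b0 (mxnormM _ _ _ _ _)) _.
  by rewrite mulrAC cd0 mul0r mulr0.
have {}cd0 : 0 < opnorm c * opnorm d by rewrite lt_def cd0 mulr_ge0// opnorm_ge0.
rewrite -ler_pdivrMl//; apply: le_Kfun => u; rewrite ler_pdivrMl//.
apply: le_trans (Kfun_le _ (mxsandwich c u d)) _.
have -> : mxsandwich c x d - map_mx T (mxsandwich c u d) = mxsandwich c (x - map_mx T u) d.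
  rewrite map_mxsandwich; apply/eqP; rewrite subr_eq -mxsandwichD subrK//.
rewrite mulrDr; apply: lerD; rewrite mulrCA ler_wpM2l// mulrAC; exact: mxnormM.
Qed.

Lemma Kfun_le_mxnorm n (x : 'M[F]_n) : Kfun x <= b * mxnorm x.
Proof.
apply: le_trans (Kfun_le _ 0) _.
have -> : x - map_mx T 0 = x by apply/matrixP => i j; rewrite !mxE linear0 subr0.
by rewrite (mxseminorm0 (mxnorm_ruan E).1) mulr0 add0r.
Qed.

Lemma Kfun_range_le n (u : 'M[E]_n) : Kfun (map_mx T u) <= a * mxnorm u.
Proof.
apply: le_trans (Kfun_le _ u) _.
by rewrite subrr (mxseminorm0 (mxnorm_ruan F).1) mulr0 addr0.
Qed.

End K_functional.

(** * The interpolation seminorms *)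

Section interpolation_seminorms.
Variables (R : realType) (E F : opSpaceType R) (T : {linear E -> F}) (c : R).
Hypotheses (c0 : 0 <= c)
  (Tc : forall n (x : 'M[E]_n), mxnorm (map_mx T x) <= c * mxnorm x).

Definition weight (k : nat) : R := Num.sqrt (2^-1 ^+ k.+1).

Lemma weight_sqr k : weight k ^+ 2 = 2^-1 ^+ k.+1.
Proof. by rewrite sqr_sqrtr// exprn_ge0// invr_ge0. Qed.

Lemma weight_ge0 k : 0 <= weight k.
Proof. exact: sqrtr_ge0. Qed.

Lemma half_pow_gt0 k : 0 < (2^-1 : R) ^+ k.
Proof. by rewrite exprn_gt0// invr_gt0. Qed.

Lemma le_weight k : 2^-1 ^+ k.+1 <= weight k.
Proof.
rewrite -(@ler_pXn2r _ 2) ?nnegrE ?weight_ge0 ?(ltW (half_pow_gt0 _))// weight_sqr.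
by rewrite expr2 ler_piMl ?(ltW (half_pow_gt0 _))// exprn_ile1// ?invr_ge0// invf_le1// ler1n.
Qed.

Lemma sum_weight_sqr N : \sum_(0 <= k < N) weight k ^+ 2 = 1 - 2^-1 ^+ N.
Proof.
elim: N => [|N IH]; first by rewrite big_geq// subrr.
rewrite big_nat_recr//= IH weight_sqr [in RHS]exprS.
by rewrite exprS; field.
Qed.

Lemma half_pow_small (e : R) : 0 < e -> exists N, 2^-1 ^+ N < e.
Proof.
move=> e0; pose N := Num.Def.archi_bound e^-1; exists N.
have e1 : 0 <= e^-1 by rewrite invr_ge0 ltW.
have h : e^-1 < N%:R by have := archi_boundP e1.
rewrite exprVn -[ltRHS]invrK ltf_pV2 ?posrE ?exprn_gt0 ?invr_gt0//.
apply: lt_trans h _; rewrite -natrX ltr_nat.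
exact: ltn_expl.
Qed.

Definition wK k n (x : 'M[F]_n) : R := Kfun T (c * weight k) (4 ^+ k * weight k) x.

Definition interp_seminorm N n (x : 'M[F]_n) : R :=
  l2 (index_iota 0 N) xpredT (fun k => wK k x).

Let a0 k : 0 <= c * weight k. Proof. by rewrite mulr_ge0// weight_ge0. Qed.
Let b0 k : 0 <= 4 ^+ k * weight k.
Proof. by rewrite mulr_ge0 ?weight_ge0// exprn_ge0. Qed.

Lemma wK_mxseminorm k : mxseminorm (wK k).
Proof. exact: Kfun_mxseminorm. Qed.

Lemma interp_mxseminorm N : mxseminorm (interp_seminorm N).
Proof. by apply: l2_mxseminorm => k; exact: wK_mxseminorm. Qed.

Lemma interp_seminorm_le_mxnorm N : exists C, forall n (x : 'M[F]_n),
  interp_seminorm N x <= C * mxnorm x.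
Proof.
exists (l2 (index_iota 0 N) xpredT (fun k => 4 ^+ k * weight k)) => n x.
rewrite mulrC -l2Z ?mxnorm_ge0//; apply: le_l2 => k _.
by rewrite Kfun_ge0//= mulrC Kfun_le_mxnorm.
Qed.

(** From |x| <= |T u| + |x - T u|, |T u| <= c |u| and 4^k >= 1. *)
Lemma wK_ge k n (x : 'M[F]_n) : weight k * mxnorm x <= wK k x.
Proof.
apply: le_Kfun => u.
have -> : mxnorm x = mxnorm (map_mx T u + (x - map_mx T u)) by rewrite addrC subrK.
apply: le_trans (ler_wpM2l (weight_ge0 _) (mxnormD _ _ _)) _.
rewrite mulrDr; apply: lerD; first by rewrite (mulrC c) -mulrA ler_wpM2l ?weight_ge0.
rewrite -mulrA ler_peMl ?mulr_ge0 ?weight_ge0 ?mxnorm_ge0//.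
by rewrite exprn_ege1// ler1n.
Qed.

(** Summing the squares of [wK_ge] gives (1 - 2^(-N)) |x|^2 <= r^2 for all N. *)
Lemma mxnorm_le_interp n (x : 'M[F]_n) r :
  (forall N, interp_seminorm N x <= r) -> mxnorm x <= r.
Proof.
move=> h; have r0 : 0 <= r by apply: le_trans (h 0%N); exact: l2_ge0.
rewrite -(@ler_pXn2r _ 2) ?nnegrE ?mxnorm_ge0//.
have h2 N : (1 - 2^-1 ^+ N) * mxnorm x ^+ 2 <= r ^+ 2.
  apply: (@le_trans _ _ (interp_seminorm N x ^+ 2)); last first.
    by rewrite ler_pXn2r ?nnegrE ?l2_ge0.
  rewrite l2_sqr -sum_weight_sqr mulr_suml; apply: ler_sum => k _.
  by rewrite -exprMn ler_pXn2r ?nnegrE ?mulr_ge0 ?weight_ge0 ?mxnorm_ge0 ?Kfun_ge0// wK_ge.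
apply/ler_eps => e e0.
have d0 : 0 < 1 + mxnorm x ^+ 2 by rewrite ltr_pwDl// sqr_ge0.
have [N hN] := half_pow_small (divr_gt0 e0 d0).
have := h2 N; rewrite mulrBl mul1r lerBlDr => /le_trans; apply; rewrite lerD2l.
move: hN; rewrite ltr_pdivlMr// => /ltW; apply: le_trans.
by rewrite ler_wpM2l ?(ltW (half_pow_gt0 _))// lerDr.
Qed.

Lemma interp_seminorm_range N n (u : 'M[E]_n) :
  interp_seminorm N (map_mx T u) <= c * mxnorm u.
Proof.
rewrite -(@ler_pXn2r _ 2) ?nnegrE ?l2_ge0 ?mulr_ge0 ?mxnorm_ge0//.
rewrite l2_sqr; apply: (@le_trans _ _ ((1 - 2^-1 ^+ N) * (c * mxnorm u) ^+ 2)).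
  rewrite -sum_weight_sqr mulr_suml; apply: ler_sum => k _.
  rewrite -exprMn ler_pXn2r ?nnegrE ?mulr_ge0 ?weight_ge0 ?mxnorm_ge0 ?Kfun_ge0//.
  by apply: le_trans (Kfun_range_le T (a0 k) (b0 k) u) _; rewrite mulrA [weight k * c]mulrC.
by rewrite ler_piMl ?sqr_ge0// gerBl ltW// half_pow_gt0.
Qed.

(** A single large k suffices. A near-optimal u in the infimum defining [wK k] has c w_k |u| and 4^k
    w_k |x - T u| below M + 1, and 4^k w_k >= 2^k / 2. *)
Lemma interp_approx (M e : R) : 0 <= M -> 0 < e -> exists2 C, 0 <= C &
  forall x : F, (forall N, interp_seminorm N (const_mx x : 'M_1) <= M) ->
    exists2 u, rnorm u <= C & rnorm (x - T u) <= e.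
Proof.
move=> M0 e0; have M1 : 0 < M + 1 by rewrite ltr_wpDl.
have e2 : 0 < e / (2 * (M + 1)) by rewrite divr_gt0// mulr_gt0.
have [k hk] := half_pow_small e2.
have w0 : 0 < weight k by apply: lt_le_trans (le_weight k); exact: half_pow_gt0.
exists ((M + 1) / (c * weight k)); first by rewrite divr_ge0// ltW.
move=> x hx.
have : wK k (const_mx x : 'M_1) < M + 1.
  apply: (@le_lt_trans _ _ M); last by rewrite ltrDl.
  (* The partial sum of index N stops before N, so [k.+1] is the first that contains the term k. *)
  apply: le_trans (hx k.+1).
  rewrite -(@ler_pXn2r _ 2) ?nnegrE ?l2_ge0 ?Kfun_ge0// l2_sqr big_nat_recr//= lerDr.
  by apply: sumr_ge0 => i _; exact: sqr_ge0.
move=> /Kfun_lt[u0]; set u := u0 0 0.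
have -> : u0 = const_mx u by apply/matrixP => i j; rewrite mxE !ord1.
have -> : const_mx x - map_mx T (const_mx u) = const_mx (x - T u) :> 'M_1.
  by apply/matrixP => i j; rewrite !mxE.
rewrite !mxnorm_rnorm => hu.
have hu1 : c * weight k * rnorm u <= M + 1.
  by apply: le_trans (ltW hu); rewrite lerDl mulr_ge0// rnorm_ge0.
have hu2 : rnorm (x - T u) <= e.
  have : 4 ^+ k * weight k * rnorm (x - T u) <= M + 1.
    by apply: le_trans (ltW hu); rewrite lerDr mulr_ge0// rnorm_ge0.
  have b1 : 2 ^+ k / 2 <= 4 ^+ k * weight k.
    have -> : (2 ^+ k / 2 : R) = 4 ^+ k * 2^-1 ^+ k.+1.
      have -> : (4 : R) = 2 * 2 by rewrite -natrM.
      rewrite exprMn exprS exprVn -mulrA; congr (_ * _).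
      by rewrite mulrCA mulfV ?mulr1// expf_neq0.
    by rewrite ler_wpM2l ?le_weight// exprn_ge0.
  move=> /(le_trans (ler_wpM2r (rnorm_ge0 _) b1)).
  have p0 : 0 < (2 : R) ^+ k by rewrite exprn_gt0.
  rewrite -ler_pdivlMl ?divr_gt0// => /le_trans; apply.
  have -> : (2 ^+ k / 2)^-1 * (M + 1) = 2^-1 ^+ k * (2 * (M + 1)).
    by rewrite exprVn; field; rewrite gt_eqF.
  by rewrite -ler_pdivlMr ?mulr_gt0// ltW.
(* For c = 0 the bound on [u] is 0, by the convention that 0 has inverse 0. Then T u = 0, and 0 can
   replace [u]. *)
have [cz|cz] := eqVneq c 0.
  exists 0; first by rewrite rnorm0 cz mul0r invr0 mulr0.
  suff Tu0 : T u = 0 by rewrite linear0 subr0; rewrite Tu0 subr0 in hu2.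
  apply/rnorm_eq0/le_anti; rewrite rnorm_ge0 andbT -mxnorm_rnorm.
  have := Tc (const_mx u : 'M_1); rewrite cz mul0r.
  by have -> : map_mx T (const_mx u) = const_mx (T u) :> 'M_1 by apply/matrixP => i j; rewrite !mxE.
exists u => //; rewrite ler_pdivlMr; first by rewrite mulrC.
by rewrite mulr_gt0// lt_def cz.
Qed.

End interpolation_seminorms.

Section interpolation_action.
Variables (R : realType) (A : ccAlgebraType R) (E F : ccModuleType A).
Variables (T : {linear E -> F}) (c : R).
Hypotheses (c0 : 0 <= c) (Th : module_hom T).

(** If u competes in the infimum for x, then v acting on u competes for v acting on x, because [T]
    commutes with the action. *)
Lemma interp_seminorm_act N p q (v : 'M[A]_p) (x : 'M[F]_q) :
  interp_seminorm T c N (mxbil act v x) <= mxnorm v * interp_seminorm T c N x.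
Proof.
have /extends_ccP aE := @act_cc _ A E; have /extends_ccP aF := @act_cc _ A F.
rewrite -l2Z ?mxnorm_ge0//; apply: le_l2 => k _.
have a0 : 0 <= c * weight R k by rewrite mulr_ge0// weight_ge0.
have b0 : 0 <= 4 ^+ k * weight R k by rewrite mulr_ge0 ?weight_ge0// exprn_ge0.
rewrite Kfun_ge0//=.
have step (u : 'M[E]_q) : wK T c k (mxbil act v x) <=
    mxnorm v * (c * weight R k * mxnorm u + 4 ^+ k * weight R k * mxnorm (x - map_mx T u)).
  apply: le_trans (Kfun_le T a0 b0 _ (mxbil act v u)) _.
  have -> : mxbil act v x - map_mx T (mxbil act v u) = mxbil act v (x - map_mx T u).
    by apply/matrixP => i j; rewrite !mxE Th linearBr.
  rewrite mulrDr; apply: lerD; rewrite mulrCA ler_wpM2l//; [exact: aE|exact: aF].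
have [v0|v0] := eqVneq (mxnorm v) 0.
  by have := step 0; rewrite v0 !mul0r.
have {}v0 : 0 < mxnorm v by rewrite lt_def v0 mxnorm_ge0.
by rewrite -ler_pdivrMl//; apply: le_Kfun => u; rewrite ler_pdivrMl.
Qed.

End interpolation_action.

(** * The interpolation space *)

(** Bundled so that the type [interp] and its canonical structures depend on one parameter, which
    carries the bound and its proofs. *)
Record cb_module_map (R : realType) (A : ccAlgebraType R) (E F : ccModuleType A) := {
  cbm_map : {linear E -> F};
  cbm_bound : R;
  cbm_bound_ge0 : 0 <= cbm_bound;
  cbm_bounded : forall n (x : 'M[E]_n),
    mxnorm (map_mx cbm_map x) <= cbm_bound * mxnorm x;
  cbm_hom : module_hom cbm_map }.

Section interpolation_space.
Variables (R : realType) (A : ccAlgebraType R) (E F : ccModuleType A).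
Variable D : cb_module_map E F.

Let T := cbm_map D.
Let c := cbm_bound D.
Let c0 : 0 <= c := cbm_bound_ge0 D.
Let Tc := @cbm_bounded _ _ _ _ D.
Let S N n (x : 'M[F]_n) := interp_seminorm T c N x.

Definition interp_pred : {pred F} :=
  fun x => `[< exists r, forall N, S N (const_mx x : 'M_1) <= r >].

Record interp := Interp { interp_fun : F; _ : interp_fun \in interp_pred }.

HB.instance Definition _ := [isSub for interp_fun].
HB.instance Definition _ := [Choice of interp by <:].

Lemma interp_pred_submod : submod_closed interp_pred.
Proof.
split=> [|a x y].
  apply/asboolP; exists 0 => N.
  by rewrite /S (mxseminorm0 (interp_mxseminorm _ c0 N)).
move=> /asboolP[r hr] /asboolP[s hs]; apply/asboolP; exists (absc a * r + s) => N.
have hS := interp_mxseminorm T c0 N; have [_ hD _] := hS.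
have -> : const_mx (a *: x + y) = map_mx ( *:%R a) (const_mx x) + const_mx y :> 'M_1.
  by apply/matrixP => i j; rewrite !mxE.
apply: le_trans (hD _ _ _) _; apply: lerD => //.
by rewrite (mxseminormZ hS) ler_wpM2l ?absc_ge0.
Qed.

HB.instance Definition _ := GRing.isSubmodClosed.Build R[i] F
  interp_pred interp_pred_submod.
HB.instance Definition _ := [SubChoice_isSubLmodule of interp by <:].

Definition interp_val : {linear interp -> F} := (val : interp -> F).

Definition interp_sys N n (x : 'M[interp]_n) : R := S N (map_mx interp_val x).

Lemma interp_sys_mxseminorm N : mxseminorm (interp_sys N).
Proof.
have [h0 hD hM] := interp_mxseminorm T c0 N.
split=> [n x|n x y|m n a x b]; first exact: h0.
  by rewrite /interp_sys map_mxD; exact: hD.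
by rewrite /interp_sys map_mxsandwich; exact: hM.
Qed.

Lemma interp_sys_bounded (x : interp) :
  exists r, forall N, interp_sys N (const_mx x : 'M_1) <= r.
Proof.
by have /asboolP[r h] := valP x; exists r => N; rewrite /interp_sys map_const_mx; exact: h.
Qed.

Definition interp_mxnorm n (x : 'M[interp]_n) : R := ruan_hull interp_sys x.

Lemma interp_mxnorm_ruan : ruan interp_mxnorm.
Proof. exact: (hull_admissible interp_sys_mxseminorm interp_sys_bounded).1. Qed.

Lemma interp_mxnormZ n a (x : 'M[interp]_n) :
  interp_mxnorm (map_mx ( *:%R a) x) = absc a * interp_mxnorm x.
Proof. exact: (mxseminormZ interp_mxnorm_ruan.1). Qed.

Lemma interp_val_cc n (x : 'M[interp]_n) :
  mxnorm (map_mx interp_val x) <= interp_mxnorm x.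
Proof.
apply: (admissible_le_hull interp_sys_mxseminorm interp_sys_bounded
  (nu := fun n (x : 'M[interp]_n) => mxnorm (map_mx interp_val x))).
have [[h0 hD hM] hd] := mxnorm_ruan F.
split; first split; first split=> [m y|m y z|m k a y b].
- exact: h0.
- by rewrite map_mxD; exact: hD.
- by rewrite map_mxsandwich; exact: hM.
- by move=> m k y z; rewrite map_block_mx !raddf0; exact: hd.
- by move=> m y r; exact: mxnorm_le_interp.
Qed.

Lemma interp_mxnorm_eq0 n (x : 'M[interp]_n) : interp_mxnorm x = 0 -> x = 0.
Proof.
move=> x0; have : mxnorm (map_mx interp_val x) = 0.
  by apply/le_anti; rewrite mxnorm_ge0 -{1}x0 interp_val_cc.
move=> /mxnorm_eq0 /matrixP h; apply/matrixP => i j; apply: val_inj.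
by have := h i j; rewrite !mxE.
Qed.

Definition interp_norm (x : interp) : R[i] := (interp_mxnorm (const_mx x : 'M_1))%:C.

Lemma interp_normD x y : interp_norm (x + y) <= interp_norm x + interp_norm y.
Proof.
rewrite -rmorphD /= lecR.
have -> : const_mx (x + y) = const_mx x + const_mx y :> 'M_1.
  by apply/matrixP => i j; rewrite !mxE.
by have [[_ h _] _] := interp_mxnorm_ruan; exact: h.
Qed.

Lemma interp_normZ a x : interp_norm (a *: x) = `|a| * interp_norm x.
Proof.
rewrite -absc_norm -rmorphM /= -interp_mxnormZ; congr (interp_mxnorm _)%:C.
by apply/matrixP => i j; rewrite !mxE.
Qed.

Lemma interp_norm_eq0 x : interp_norm x = 0 -> x = 0.
Proof.
by move=> [] /interp_mxnorm_eq0 /matrixP /(_ 0 0); rewrite !mxE.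
Qed.

HB.instance Definition _ := Lmodule_isNormed.Build R[i] interp
  interp_normD interp_normZ interp_norm_eq0.

Lemma interp_rnormE (x : interp) : rnorm x = interp_mxnorm (const_mx x : 'M_1).
Proof. by []. Qed.

Lemma interp_rnormP (x : interp) r :
  rnorm x <= r <-> forall N, S N (const_mx (interp_val x) : 'M_1) <= r.
Proof.
rewrite interp_rnormE /interp_mxnorm.
have H := hull1P interp_sys_mxseminorm interp_sys_bounded x r.
split=> [/H h N|h]; first by have := h N; rewrite /interp_sys map_const_mx.
by apply/H => N; rewrite /interp_sys map_const_mx.
Qed.

Lemma interp_val_le (x : interp) : rnorm (interp_val x) <= rnorm x.
Proof.
rewrite -mxnorm_rnorm interp_rnormE.
by have := interp_val_cc (const_mx x : 'M_1); rewrite map_const_mx.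
Qed.

Lemma interp_onto (y : F) r : (forall N, S N (const_mx y : 'M_1) <= r) ->
  exists x : interp, interp_val x = y.
Proof.
move=> h; have yP : y \in interp_pred by apply/asboolP; exists r.
by exists (Interp yP).
Qed.

Let S1_seminorm N : seminorm (fun y : F => S N (const_mx y : 'M_1)).
Proof.
have hS := interp_mxseminorm T c0 N; have [_ hD _] := hS.
split=> [x y|a x].
  have -> : const_mx (x + y) = const_mx x + const_mx y :> 'M_1.
    by apply/matrixP => i j; rewrite !mxE.
  exact: hD.
rewrite -(mxseminormZ hS); congr (S N _).
by apply/matrixP => i j; rewrite !mxE.
Qed.

(** The limit [l] is taken in [F]. Each partial seminorm is continuous for the norm of [F], so
    bounds on x - y pass to x - l for every N, which is [key]. *)
Lemma interp_complete (FF : set_system interp) : ProperFilter FF -> cauchy FF -> cvg FF.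
Proof.
move=> FFp /cauchyP FFc.
have {}FFc e : 0 < e -> exists x : interp, FF [set y | rnorm (x - y) < e].
  move=> e0; have [|x hx] := FFc e%:C; first by rewrite ltcR.
  exists x; apply: filterS hx => y; rewrite -ball_normE /= -rnormC ltcR//.
have [|l hl] := @rcauchy_cvg _ F (interp_val @ FF) _.
  move=> e /FFc[x hx]; exists (interp_val x); apply: (@filterS _ FF _ _ _ _ hx) => y hy.
  apply: (@le_lt_trans _ _ (rnorm (interp_val (x - y)))).
    by rewrite linearB.
  by apply: le_lt_trans hy; exact: interp_val_le.
have key e x : FF [set y | rnorm (x - y) < e] -> forall N,
    S N (const_mx (interp_val x - l) : 'M_1) <= e.
  move=> hx N; apply/ler_eps => d d0.
  have [C hC] := interp_seminorm_le_mxnorm T c0 N.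
  pose d' := d / (1 + `|C|).
  have C1 : 0 < 1 + `|C| by rewrite ltr_pwDl.
  have d'0 : 0 < d' by rewrite divr_gt0.
  have [y [/= /ltW hy /ltW hyl]] := filter_ex (@filterI _ FF _ _ _ hx (hl _ d'0)).
  have -> : interp_val x - l = interp_val (x - y) + - (l - interp_val y).
    by rewrite linearB opprB addrA subrK.
  apply: le_trans ((S1_seminorm N).1 _ _) _; apply: lerD.
    by have /interp_rnormP := hy.
  apply: le_trans (hC _ _) _; rewrite mxnorm_rnorm rnormN.
  apply: le_trans (ler_wpM2r (rnorm_ge0 _) (ler_norm C)) _.
  have -> : d = (1 + `|C|) * d' by rewrite /d' mulrC divfK// gt_eqF.
  by apply: ler_pM => //; [exact: rnorm_ge0|rewrite lerDr].
(* [key] puts the difference x1 - l into the space, as [z]; the limit is then recovered as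
   [x1 - z]. *)
have [x1 hx1] := FFc 1 ltr01.
have [z hz] := interp_onto (key _ _ hx1).
have {hz} lE : l = interp_val (x1 - z) by rewrite linearB hz opprB addrC subrK.
apply/cvg_ex; exists (x1 - z) => U /rnbhsP[e e0 hU].
have e2 : 0 < e / 4 by rewrite divr_gt0.
have [x hx] := FFc _ e2.
have hxz : rnorm (x - (x1 - z)) <= e / 4.
  apply/interp_rnormP => N; rewrite linearB -lE; exact: key.
apply: filterS hx => y hy; apply: hU.
have -> : x1 - z - y = - (x - (x1 - z)) + (x - y).
  by rewrite opprB addrA subrK.
apply: le_lt_trans (rnormD _ _) _; rewrite rnormN.
by apply: le_lt_trans (lerD hxz (ltW hy)) _; lra.
Qed.

HB.instance Definition _ := Uniform_isComplete.Build interp interp_complete.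

Lemma interp_mxnorm1 (x : interp) : (interp_mxnorm (const_mx x : 'M_1))%:C = `|x|.
Proof. by []. Qed.

Lemma interp_mxnormD n (x y : 'M[interp]_n) :
  interp_mxnorm (x + y) <= interp_mxnorm x + interp_mxnorm y.
Proof. by have [[_ h _] _] := interp_mxnorm_ruan; exact: h. Qed.

Lemma interp_mxnorm_dsum m n (x : 'M[interp]_m) (y : 'M[interp]_n) :
  interp_mxnorm (block_mx x 0 0 y) = Num.max (interp_mxnorm x) (interp_mxnorm y).
Proof. exact: (ruan_dsum x y interp_mxnorm_ruan). Qed.

Lemma interp_mxnormM m n (a : 'M[R[i]]_(m, n)) (x : 'M[interp]_n) (b : 'M[R[i]]_(n, m)) :
  interp_mxnorm (mxsandwich a x b) <= opnorm a * interp_mxnorm x * opnorm b.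
Proof. by have [[_ _ h] _] := interp_mxnorm_ruan; exact: h. Qed.

HB.instance Definition _ := isOperatorSpace.Build R interp
  interp_mxnorm1 interp_mxnorm_eq0 interp_mxnormZ interp_mxnormD
  interp_mxnorm_dsum interp_mxnormM.

End interpolation_space.

(** * The module structure and the factorisation *)

Section interpolation_module.
Variables (R : realType) (A : ccAlgebraType R) (E F : ccModuleType A).
Variable D : cb_module_map E F.

Let T := cbm_map D.
Let c := cbm_bound D.
Let c0 : 0 <= c := cbm_bound_ge0 D.
Let Tc := @cbm_bounded _ _ _ _ D.
Let Th : module_hom T := cbm_hom D.
Let S N n (x : 'M[F]_n) := interp_seminorm T c N x.

Lemma interp_act_subproof (a : A) (x : interp D) :
  act a (interp_val D x) \in interp_pred D.
Proof.
have /asboolP[r hr] := valP x; apply/asboolP; exists (mxnorm (const_mx a : 'M_1) * r) => N.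
have -> : const_mx (act a (interp_val D x)) =
    mxbil act (const_mx a : 'M_1) (const_mx (interp_val D x) : 'M_1).
  by apply/matrixP => i j; rewrite !mxE.
have h := interp_seminorm_act c0 Th N (const_mx a : 'M_1) (const_mx (interp_val D x) : 'M_1).
apply: le_trans h _.
by rewrite ler_wpM2l ?mxnorm_ge0//; exact: hr.
Qed.

Definition interp_act (a : A) (x : interp D) : interp D := Interp (interp_act_subproof a x).

Lemma interp_act_bilinear : bilinear_for (GRing.Scale.Law.clone _ _ *:%R _)
  (GRing.Scale.Law.clone _ _ *:%R _) interp_act.
Proof.
split=> [x d a b|a d x y]; apply: val_inj.
  by rewrite linearP /= linearPl.
by rewrite linearP /= !linearP.
Qed.

HB.instance Definition _ := bilinear_isBilinear.Build R[i] A (interp D) (interp D)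
  _ _ interp_act interp_act_bilinear.

Lemma interp_actA (a b : A) (x : interp D) :
  interp_act a (interp_act b x) = interp_act (amul a b) x.
Proof. by apply: val_inj; rewrite /= actA. Qed.

(* For fixed [v], [x |-> nu (v x) / t] is an admissible system as soon as
   [mxnorm v <= t]; hence it is dominated by the norm of the interpolation space. *)
Lemma interp_act_cc : extends_cc interp_act.
Proof.
apply/extends_ccP => p q v w; apply: hull_le => [N|nu hnu].
  exact: interp_sys_mxseminorm.
have w0 : 0 <= interp_mxnorm w := mxnorm_ge0 w.
apply/ler_eps => e e0.
(* [t] is positive even if [v] has norm 0, and its excess over [mxnorm v] costs at most [e] after
   multiplication by the norm of [w]. *)
pose t := mxnorm v + e / (1 + interp_mxnorm w).
have w1 : 0 < 1 + interp_mxnorm w by rewrite ltr_pwDl.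
have d0 : 0 < e / (1 + interp_mxnorm w) by rewrite divr_gt0.
have t0 : 0 < t by rewrite ltr_wpDl ?mxnorm_ge0.
have adm : admissible (interp_sys (D := D)) (pull_bil interp_act v nu t).
  split; first exact: (pull_bil_ruan _ _ t0 hnu.1).
  move=> n x r h; rewrite /pull_bil ler_pdivrMl//; apply: hnu.2 => N.
  have -> : interp_sys N (mxbil interp_act v x) = S N (mxbil act v (map_mx (interp_val D) x)).
    by congr (S N _); apply/matrixP => i j; rewrite !mxE.
  apply: le_trans (interp_seminorm_act c0 Th _ _ _) _.
  have hN := h N; have r0 : 0 <= r by apply: le_trans hN; have [] := interp_sys_mxseminorm D N.
  apply: (@le_trans _ _ (mxnorm v * r)); first by rewrite ler_wpM2l ?mxnorm_ge0.
  by rewrite ler_wpM2r// lerDl ltW.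
have := admissible_le_hull (@interp_sys_mxseminorm _ _ _ _ D) (@interp_sys_bounded _ _ _ _ D) w adm.
rewrite /pull_bil ler_pdivrMl// => /le_trans; apply.
rewrite /t mulrDl lerD2l -/(interp_mxnorm w).
by rewrite mulrAC ler_pdivrMr// ler_pM2l// lerDr.
Qed.

HB.instance Definition _ := OperatorSpace_isCCModule.Build R A (interp D)
  interp_actA interp_act_cc.

Lemma interp_val_hom : module_hom (interp_val D).
Proof. by []. Qed.

Lemma interp_lift_subproof (x : E) : T x \in interp_pred D.
Proof.
apply/asboolP; exists (c * rnorm x) => N.
have -> : const_mx (T x) = map_mx T (const_mx x : 'M_1).
  by apply/matrixP => i j; rewrite !mxE.
by rewrite -mxnorm_rnorm; exact: interp_seminorm_range.
Qed.

Definition interp_lift (x : E) : interp D := Interp (interp_lift_subproof x).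

Lemma interp_lift_linear : linear interp_lift.
Proof. by move=> a x y; apply: val_inj; rewrite /= !linearP. Qed.

HB.instance Definition _ := GRing.isLinear.Build R[i] E (interp D) *:%R
  interp_lift interp_lift_linear.

Lemma interp_lift_hom : module_hom (interp_lift : {linear E -> interp D}).
Proof. by move=> a x; apply: val_inj; rewrite /= Th. Qed.

Lemma interp_lift_bound n (x : 'M[E]_n) : mxnorm (map_mx interp_lift x) <= c * mxnorm x.
Proof.
apply: hull_le => [N|nu hnu]; first exact: interp_sys_mxseminorm.
apply: hnu.2 => N; apply: le_trans (interp_seminorm_range T c0 N x).
rewrite /interp_sys le_eqVlt; apply/orP; left; apply/eqP; congr interp_seminorm.
by apply/matrixP => i j; rewrite !mxE.
Qed.

Lemma interp_reflexive : weakly_compact T -> reflexive_space (interp D).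
Proof.
move=> Twc Phi [M hM].
apply: (@bidual_represented R E (interp D) F T (interp_val D)
  (fun k y => wK T c k (const_mx y : 'M_1)) _ _ _ _ _ _ Twc Phi `|M|).
- move=> k; have hK := wK_mxseminorm T c0 k; have [_ hD _] := hK.
  split=> [x y|a x].
    have -> : const_mx (x + y) = const_mx x + const_mx y :> 'M_1 by apply/matrixP => i j; rewrite !mxE.
    exact: hD.
  rewrite -(mxseminormZ hK); congr (wK T c k _).
  by apply/matrixP => i j; rewrite !mxE.
- move=> N; have [C hC] := interp_seminorm_le_mxnorm T c0 N; exists C => y.
  by rewrite -mxnorm_rnorm; exact: hC.
- move=> g r; exact: interp_rnormP.
- move=> y r; exact: interp_onto.
- exact: interp_val_le.
- move=> N e N0 e0; have [C C0 hC] := interp_approx c0 Tc N0 e0.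
  by exists C => // g /interp_rnormP; exact: hC.
- exact: normr_ge0.
- move=> phi; apply: le_trans (hM phi) _.
  by rewrite ler_wpM2r ?dual_norm_ge0// ler_norm.
Qed.

End interpolation_module.

Theorem theorem4p4 (R : realType) (A : ccAlgebraType R) (E F : ccModuleType A)
    (T : {linear E -> F}) :
  completely_bounded T -> module_hom T ->
  (weakly_compact T <->
   exists (G : ccModuleType A) (iota : {linear G -> F}) (S : {linear E -> G}),
     [/\ reflexive_space G,
         injective iota /\ complete_contraction iota,
         completely_bounded S /\ cbnorm S = cbnorm T,
         (forall x, T x = iota (S x)) &
         module_hom S /\ module_hom iota]).
Proof.
move=> Tcb Th; have [c [c0 cE Tc]] := completely_bounded_norm Tcb.
have rn (X Y : opSpaceType R) (f : {linear X -> Y}) d :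
    (forall n (x : 'M[X]_n), mxnorm (map_mx f x) <= d * mxnorm x) ->
    forall x, rnorm (f x) <= d * rnorm x.
  move=> h x; rewrite -!mxnorm_rnorm; have := h _ (const_mx x : 'M_1).
  by rewrite map_const_mx.
split=> [Twc|[G [iota [S [Grefl [_ icc] [Scb _] TE _]]]]]; last first.
  have [d [_ _ Sd]] := completely_bounded_norm Scb.
  have /(cbnorm_le _ ler01) i1 := icc.
  have -> : (T : E -> F) = (fun x => iota (S x)) by apply/funext.
  apply: (factor_weakly_compact Grefl (C := 1) (D := d)); exact: rn.
pose D := {| cbm_map := T; cbm_bound := c; cbm_bound_ge0 := c0; cbm_bounded := Tc; cbm_hom := Th |}.
have iotac n (x : 'M[interp D]_n) : mxnorm (map_mx (interp_val D) x) <= 1 * mxnorm x.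
  by rewrite mul1r; exact: interp_val_cc.
pose S : {linear E -> interp D} := interp_lift D.
have Sc : (cbnorm S <= c%:E)%E by apply/(cbnorm_le _ c0) => n x; exact: interp_lift_bound.
exists (interp D : ccModuleType A), (interp_val D), S.
split; [exact: interp_reflexive | | | by [] | ].
- by split; [exact: val_inj|apply/(cbnorm_le _ ler01)].
- split; first by apply: le_lt_trans Sc _; rewrite ltry.
  (* The remaining inequality holds because [T] is [S] followed by a complete contraction. *)
  apply/le_anti; rewrite cE Sc /= -cE.
  apply: ge_ereal_sup => _ [n [x [x1 ->]]].
  apply: (@le_trans _ _ (mxnorm (map_mx S x))%:E).
    rewrite lee_fin; have := iotac _ (map_mx S x); rewrite mul1r; apply: le_trans.
    rewrite le_eqVlt; apply/orP; left; apply/eqP; congr mxnorm.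
    by apply/matrixP => i j; rewrite !mxE.
  by apply: ereal_sup_ubound; exists n, x.
- split; [exact: interp_lift_hom|exact: interp_val_hom].
Qed.
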